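(* Let $V$ be a countable transitive model of ZFC+CH, $M\in V$ an $\omega_1$-saturated non-standard model of true arithmetic of cardinality $\omega_1$, $\Omega\in M$ non-standard, $\mathcal{R}$ a collection of random variables on $\Omega$, and $G$ a $V$-generic filter for $\mathcal{A}^+_{M,\Omega}$. Then $M[G]^{\mathcal{R}}$ is a substructure of $M[G]^{\mathcal{R}_{\max}}$: for every atomic formula $\varphi$ and all $\alpha_0,\dots,\alpha_k\in\mathcal{R}$, $M[G]^{\mathcal{R}}\models\varphi((\alpha_0)_G,\dots,(\alpha_k)_G)$ if and only if $M[G]^{\mathcal{R}_{\max}}\models\varphi((\alpha_0)_G,\dots,(\alpha_k)_G)$.
   Context: $\Omega$ is identified with $\{x\in M:x<\Omega\}$; $\mathcal{A}^+_{M,\Omega}$ is the set of subsets $A\subseteq\Omega$ coded in $M$ with $\mu_{M,\Omega}(A)=\mathrm{st}(|A|/|\Omega|)>0$ ($|\cdot|$ the $M$-cardinality, $\mathrm{st}$ the standard part), preordered by $A\subseteq^*B$ iff $\mu_{M,\Omega}(A\setminus B)=0$. A random variable is a function $\alpha:\Omega\to M$ coded by an element of $M$; $\mathcal{R}_{\max}$ is the set of all random variables; a collection $\mathcal{R}$ of random variables is assumed closed under the functions of a fixed arithmetic language $\mathcal{L}$ (applied pointwise) and to contain constant functions for the $\mathcal{L}$-constants. In $V[G]$, $\alpha_G$ is the class of $\alpha$ under $\alpha\equiv\beta$ iff $\{x:\alpha(x)=\beta(x)\}\in G$; $M[G]^{\mathcal{R}}=\{\alpha_G:\alpha\in\mathcal{R}\}$,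 with an $\mathcal{L}$-relation $R$ holding of $(\alpha_0)_G,\ldots$ iff $\{x\in\Omega:M\models R(\alpha_0(x),\ldots)\}\in G$ and functions acting pointwise. *)

(* Defs.v *)
From Stdlib Require Import Reals List Arith ClassicalEpsilon.
From Stdlib Require Import FunctionalExtensionality PropExtensionality ProofIrrelevance.
From Stdlib Require Fin.

Set Implicit Arguments.

(** * The ambient universe of sets

    Aczel's well-founded trees modulo bisimulation.  A set is a bisimulation
    class, so that equality of sets is Leibniz equality. *)

Inductive tree : Type := sup (I : Type) (f : I -> tree).

Fixpoint bisim (x y : tree) : Prop :=
  match x, y with
  | sup f, sup g =>
      (forall i, exists j, bisim (f i) (g j)) /\
      (forall j, exists i, bisim (f i) (g j))
  end.

Definition tmem (x y : tree) : Prop :=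
  match y with sup g => exists j, bisim x (g j) end.

Definition zfset : Type := { P : tree -> Prop | exists x, P = bisim x }.

Definition cls (x : tree) : zfset :=
  exist _ (bisim x) (ex_intro _ x eq_refl).

Definition rep (X : zfset) : tree :=
  proj1_sig (constructive_indefinite_description _ (proj2_sig X)).

Definition mem (X Y : zfset) : Prop := tmem (rep X) (rep Y).

Lemma bisim_refl x : bisim x x.
Proof.
  induction x as [I f IH]; simpl; split; intro i; exists i; apply IH.
Qed.

Lemma bisim_sym x : forall y, bisim x y -> bisim y x.
Proof.
  induction x as [I f IH]; intros [J g]; simpl; intros [H1 H2]; split.
  - intro j; destruct (H2 j) as [i Hi]; exists i; auto.
  - intro i; destruct (H1 i) as [j Hj]; exists j; auto.
Qed.

Lemma bisim_trans x : forall y z, bisim x y -> bisim y z -> bisim x z.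
Proof.
  induction x as [I f IH]; intros [J g] [K h]; simpl;
    intros [H1 H2] [H3 H4]; split.
  - intro i; destruct (H1 i) as [j Hj]; destruct (H3 j) as [k Hk].
    exists k; eauto.
  - intro k; destruct (H4 k) as [j Hj]; destruct (H2 j) as [i Hi].
    exists i; eauto.
Qed.

Lemma cls_eq x y : bisim x y -> cls x = cls y.
Proof.
  intro H. unfold cls.
  assert (E : bisim x = bisim y).
  { apply functional_extensionality; intro z; apply propositional_extensionality.
    split; intro H'; eapply bisim_trans; eauto using bisim_sym. }
  apply eq_sig_hprop; [intros; apply proof_irrelevance | exact E].
Qed.

Lemma cls_rep X : cls (rep X) = X.
Proof.
  unfold cls, rep.
  destruct (constructive_indefinite_description _ (proj2_sig X)) as [x Hx]; simpl.
  apply eq_sig_hprop; [intros; apply proof_irrelevance | symmetry; exact Hx].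
Qed.

Lemma rep_cls x : bisim (rep (cls x)) x.
Proof.
  assert (H : proj1_sig (cls (rep (cls x))) = proj1_sig (cls x))
    by (rewrite cls_rep; reflexivity).
  simpl in H. rewrite H. apply bisim_refl.
Qed.

Lemma mem_cls (X : zfset) I (f : I -> tree) :
  mem X (cls (sup f)) <-> exists i, X = cls (f i).
Proof.
  unfold mem. pose proof (rep_cls (sup f)) as H.
  destruct (rep (cls (sup f))) as [J g]; simpl in *. destruct H as [H1 H2].
  split.
  - intros [j Hj]. destruct (H1 j) as [i Hi]. exists i.
    rewrite <- (cls_rep X). apply cls_eq. eapply bisim_trans; eauto.
  - intros [i Hi]. destruct (H2 i) as [j Hj]. exists j. subst X.
    eapply bisim_trans; [apply rep_cls | apply bisim_sym; exact Hj].
Qed.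

Lemma zfset_ext (X Y : zfset) : (forall Z, mem Z X <-> mem Z Y) -> X = Y.
Proof.
  intro H. rewrite <- (cls_rep X), <- (cls_rep Y). apply cls_eq.
  rewrite <- (cls_rep X), <- (cls_rep Y) in H.
  destruct (rep X) as [I f]; destruct (rep Y) as [J g]; simpl; split.
  - intro i. destruct (proj1 (mem_cls (cls (f i)) g)) as [j Hj].
    { apply H, mem_cls; eauto. }
    exists j. change (proj1_sig (cls (f i)) (g j)). rewrite Hj. apply bisim_refl.
  - intro j. destruct (proj1 (mem_cls (cls (g j)) f)) as [i Hi].
    { apply H, mem_cls; eauto. }
    exists i. change (proj1_sig (cls (f i)) (g j)). rewrite <- Hi. apply bisim_refl.
Qed.

Definition empty : zfset := cls (sup (fun e : Empty_set => match e with end)).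

(** [adjoin X Y] is X ∪ {Y}. *)
Definition adjoin (X Y : zfset) : zfset :=
  match rep X with
  | sup f =>
      cls (sup (fun o => match o with Some i => f i | None => rep Y end))
  end.

Lemma mem_empty Z : ~ mem Z empty.
Proof. intro H. apply mem_cls in H. destruct H as [[] _]. Qed.

Lemma mem_adjoin X Y Z : mem Z (adjoin X Y) <-> mem Z X \/ Z = Y.
Proof.
  rewrite <- (cls_rep X) at 2. unfold adjoin.
  destruct (rep X) as [I f]. rewrite !mem_cls. split.
  - intros [[i|] E]; [left; eauto | right; rewrite E; apply cls_rep].
  - intros [[i E]|E]; [exists (Some i); exact E | exists None].
    rewrite cls_rep; exact E.
Qed.

Definition upair (X Y : zfset) : zfset := adjoin (adjoin empty X) Y.

Definition pair (X Y : zfset) : zfset := upair (upair X X) (upair X Y).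

Fixpoint num (n : nat) : zfset :=
  match n with O => empty | S m => adjoin (num m) (num m) end.

Definition omega : zfset := cls (sup (fun n : nat => rep (num n))).

Lemma mem_omega Z : mem Z omega <-> exists n, Z = num n.
Proof.
  unfold omega. rewrite mem_cls.
  split; intros [n Hn]; exists n; rewrite Hn, ?cls_rep; reflexivity.
Qed.

Fixpoint tuple (n : nat) : (Fin.t n -> zfset) -> zfset :=
  match n with
  | O => fun _ => empty
  | S m => fun v => pair (v Fin.F1) (tuple (fun i => v (Fin.FS i)))
  end.

Definition elts (X : zfset) : Type := { x : zfset | mem x X }.

Definition el {X : zfset} (x : elts X) : zfset := proj1_sig x.

Definition subset (X Y : zfset) : Prop := forall z, mem z X -> mem z Y.

Definition transitive (X : zfset) : Prop := forall y, mem y X -> subset y X.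

(** [P] is the class of members of an element of V. *)
Definition set_of (V : zfset) (P : zfset -> Prop) : Prop :=
  exists s, mem s V /\ forall z, mem z s <-> P z.

(** * First-order logic

    Variables are named by natural numbers.  Equality is a logical symbol. *)

Record language := Language {
  fsym : Type;
  rsym : Type;
  far : fsym -> nat;
  rar : rsym -> nat }.

Inductive term (L : language) : Type :=
| tvar (n : nat)
| tapp (f : fsym L) (args : Fin.t (far L f) -> term L).

Inductive formula (L : language) : Type :=
| fEq (s t : term L)
| fRel (r : rsym L) (args : Fin.t (rar L r) -> term L)
| fFalse
| fImp (p q : formula L)
| fAll (n : nat) (p : formula L).

Definition atomic {L} (p : formula L) : Prop :=
  match p with fEq _ _ => True | fRel _ _ => True | _ => False end.

Record structure (L : language) (A : Type) := Structure {
  fint : forall f : fsym L, (Fin.t (far L f) -> A) -> A;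
  rint : forall r : rsym L, (Fin.t (rar L r) -> A) -> Prop }.

Definition upd {A} (e : nat -> A) (n : nat) (a : A) : nat -> A :=
  fun m => if Nat.eq_dec m n then a else e m.

Fixpoint eval {L A} (S : structure L A) (e : nat -> A) (t : term L) : A :=
  match t with
  | tvar _ n => e n
  | tapp f args => fint S f (fun i => eval S e (args i))
  end.

Fixpoint sat {L A} (S : structure L A) (e : nat -> A) (p : formula L) : Prop :=
  match p with
  | fEq s t => eval S e s = eval S e t
  | fRel r args => rint S r (fun i => eval S e (args i))
  | fFalse _ => False
  | fImp p q => sat S e p -> sat S e q
  | fAll n p => forall a, sat S (upd e n a) p
  end.

Definition sublanguage (L : language) (P : fsym L -> Prop) (Q : rsym L -> Prop)
  : language :=
  {| fsym := { f | P f };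
     rsym := { r | Q r };
     far := fun f => far L (proj1_sig f);
     rar := fun r => rar L (proj1_sig r) |}.

(** In the next two definitions a "substructure" is a subset of the type on
    which all operations are given, together with these operations. *)

Definition closed_under_functions {L A} (S : structure L A) (X : A -> Prop) :=
  forall f args, (forall i, X (args i)) -> X (fint S f args).

(** (X, S) is a substructure of (Y, T). *)
Definition is_substructure {L A} (S : structure L A) (X : A -> Prop)
    (T : structure L A) (Y : A -> Prop) : Prop :=
  closed_under_functions S X /\
  closed_under_functions T Y /\
  (forall a, X a -> Y a) /\
  (forall f args, (forall i, X (args i)) -> fint S f args = fint T f args) /\
  (forall r args, (forall i, X (args i)) -> (rint S r args <-> rint T r args)).

(** * Countable transitive models of ZFC + CH *)

Definition lang_set : language :=
  {| fsym := Empty_set;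
     rsym := unit;
     far := fun f => match f with end;
     rar := fun _ => 2 |}.

Definition set_structure (U : Type) (E : U -> U -> Prop) : structure lang_set U :=
  {| fint := fun f : fsym lang_set => match f with end;
     rint := fun _ v => E (v Fin.F1) (v (Fin.FS Fin.F1)) |}.

(** In the two schemata the free variables of [p] other than those named
    are parameters, whose values are given by [e]. *)
Record models_ZFC (U : Type) (E : U -> U -> Prop) : Prop := {
  zfc_extensionality :
    forall x y, (forall z, E z x <-> E z y) -> x = y;
  zfc_foundation :
    forall x, (exists y, E y x) -> exists y, E y x /\ forall z, E z x -> ~ E z y;
  zfc_pairing :
    forall x y, exists z, forall w, E w z <-> w = x \/ w = y;
  zfc_union :
    forall x, exists y, forall z, E z y <-> exists w, E w x /\ E z w;
  zfc_power_set :
    forall x, exists y, forall z, E z y <-> forall w, E w z -> E w x;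
  zfc_infinity :
    exists w, (exists o, E o w /\ forall z, ~ E z o) /\
      forall x, E x w -> exists y, E y w /\ forall z, E z y <-> E z x \/ z = x;
  zfc_separation :
    forall (p : formula lang_set) (e : nat -> U) x,
    exists y, forall z,
      E z y <-> E z x /\ sat (set_structure E) (upd e 0 z) p;
  zfc_replacement :
    forall (p : formula lang_set) (e : nat -> U) x,
    (forall u, E u x ->
       exists! v, sat (set_structure E) (upd (upd e 0 u) 1 v) p) ->
    exists y, forall v,
      E v y <->
      exists u, E u x /\ sat (set_structure E) (upd (upd e 0 u) 1 v) p;
  zfc_choice :
    forall x,
    (forall y, E y x -> exists z, E z y) ->
    (forall y y', E y x -> E y' x -> (exists z, E z y /\ E z y') -> y = y') ->
    exists c, forall y, E y x -> exists! z, E z y /\ E z c }.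

Definition countable_transitive_model (V : zfset) : Prop :=
  (exists f : nat -> zfset, forall x, mem x V -> exists n, f n = x) /\
  transitive V /\
  models_ZFC (fun x y : elts V => mem (el x) (el y)).

Definition is_function (f X Y : zfset) : Prop :=
  (forall z, mem z f -> exists x y, mem x X /\ mem y Y /\ z = pair x y) /\
  (forall x, mem x X -> exists! y, mem (pair x y) f).

Definition is_injection (f X Y : zfset) : Prop :=
  is_function f X Y /\
  forall x x' y, mem (pair x y) f -> mem (pair x' y) f -> x = x'.

Definition is_bijection (f X Y : zfset) : Prop :=
  is_injection f X Y /\ forall y, mem y Y -> exists x, mem (pair x y) f.

Definition countable_in (V X : zfset) : Prop :=
  exists f, mem f V /\ is_injection f X omega.

Definition is_ordinal (X : zfset) : Prop :=
  transitive X /\ forall y, mem y X -> transitive y.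

Definition is_omega1_in (V k : zfset) : Prop :=
  mem k V /\ is_ordinal k /\ ~ countable_in V k /\
  forall b, mem b k -> countable_in V b.

Definition card_omega1_in (V X : zfset) : Prop :=
  exists k f, is_omega1_in V k /\ mem f V /\ is_bijection f k X.

(** V satisfies that the power set of omega has cardinality aleph_1. *)
Definition models_CH (V : zfset) : Prop :=
  exists p, mem p V /\ (forall x, mem x p <-> mem x V /\ subset x omega) /\
            card_omega1_in V p.

(** * Arithmetic

    An arithmetic language extends 0, 1, +, *, < by sets of further function
    and relation symbols, each with an intended interpretation on the natural
    numbers. *)

Inductive pa_fun := Zero | One | Plus | Times.
Inductive pa_rel := Lt.

Record arith_language := {
  xfun : zfset;
  xrel : zfset;
  xfar : elts xfun -> nat;
  xrar : elts xrel -> nat;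
  xfint : forall f, (Fin.t (xfar f) -> nat) -> nat;
  xrint : forall r, (Fin.t (xrar r) -> nat) -> Prop }.

Definition arith (Sg : arith_language) : language :=
  {| fsym := pa_fun + elts (xfun Sg);
     rsym := pa_rel + elts (xrel Sg);
     far := fun f => match f with
                     | inl Zero => 0 | inl One => 0
                     | inl Plus => 2 | inl Times => 2
                     | inr g => xfar Sg g
                     end;
     rar := fun r => match r with
                     | inl Lt => 2
                     | inr s => xrar Sg s
                     end |}.

Definition standard (Sg : arith_language) : structure (arith Sg) nat :=
  {| fint := fun f : fsym (arith Sg) =>
       match f return (Fin.t (far (arith Sg) f) -> nat) -> nat with
       | inl Zero => fun _ => 0
       | inl One => fun _ => 1
       | inl Plus => fun v => v Fin.F1 + v (Fin.FS Fin.F1)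
       | inl Times => fun v => v Fin.F1 * v (Fin.FS Fin.F1)
       | inr g => xfint Sg g
       end;
     rint := fun r : rsym (arith Sg) =>
       match r return (Fin.t (rar (arith Sg) r) -> nat) -> Prop with
       | inl Lt => fun v => v Fin.F1 < v (Fin.FS Fin.F1)
       | inr s => xrint Sg s
       end |}.

(** Free variables are read universally, so this is the satisfaction of all
    sentences that are true in the natural numbers. *)
Definition models_true_arithmetic (Sg : arith_language) A
    (M : structure (arith Sg) A) : Prop :=
  forall p, (forall e, sat (standard Sg) e p) -> (forall e, sat M e p).

(** ** Symbols, formulas and structures as sets *)

Definition fname {Sg : arith_language} (f : fsym (arith Sg)) : zfset :=
  match f with
  | inl Zero => pair (num 0) (num 0)
  | inl One => pair (num 0) (num 1)
  | inl Plus => pair (num 0) (num 2)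
  | inl Times => pair (num 0) (num 3)
  | inr g => pair (num 1) (el g)
  end.

Definition rname {Sg : arith_language} (r : rsym (arith Sg)) : zfset :=
  match r with
  | inl Lt => pair (num 0) (num 0)
  | inr s => pair (num 1) (el s)
  end.

Fixpoint term_code {Sg : arith_language} (t : term (arith Sg)) : zfset :=
  match t with
  | tvar _ n => pair (num 0) (num n)
  | tapp f args =>
      pair (num 1) (pair (fname f) (tuple (fun i => term_code (args i))))
  end.

Fixpoint formula_code {Sg : arith_language} (p : formula (arith Sg)) : zfset :=
  match p with
  | fEq s t => pair (num 0) (pair (term_code s) (term_code t))
  | fRel r args =>
      pair (num 1) (pair (rname r) (tuple (fun i => term_code (args i))))
  | fFalse _ => pair (num 2) empty
  | fImp q q' => pair (num 3) (pair (formula_code q) (formula_code q'))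
  | fAll n q => pair (num 4) (pair (num n) (formula_code q))
  end.

Definition language_in (V : zfset) (Sg : arith_language) : Prop :=
  mem (xfun Sg) V /\ mem (xrel Sg) V /\
  set_of V (fun z => exists f, z = pair (el f) (num (xfar Sg f))) /\
  set_of V (fun z => exists r, z = pair (el r) (num (xrar Sg r))).

Definition structure_in (V : zfset) (Sg : arith_language) (D : zfset)
    (M : structure (arith Sg) (elts D)) : Prop :=
  mem D V /\
  set_of V (fun z => exists f args,
    z = pair (fname f)
             (pair (tuple (fun i => el (args i))) (el (fint M f args)))) /\
  set_of V (fun z => exists r args,
    rint M r args /\
    z = pair (rname r) (tuple (fun i => el (args i)))).

Definition scons {A} (b : A) (a : nat -> A) : nat -> A :=
  fun n => match n with O => b | S m => a m end.

(** V satisfies that M is omega_1-saturated: every set in V of formulas with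
    parameters from a countable set, here listed in V as a 0, a 1, ..., that is
    finitely satisfiable in M is realized in M.  Variable 0 is the variable of
    the type and variable i + 1 stands for the parameter a i. *)
Definition omega1_saturated_in (V : zfset) (Sg : arith_language) (D : zfset)
    (M : structure (arith Sg) (elts D)) : Prop :=
  forall (a : nat -> elts D) (p : formula (arith Sg) -> Prop),
  set_of V (fun z => exists n, z = pair (num n) (el (a n))) ->
  set_of V (fun z => exists q, p q /\ z = formula_code q) ->
  (forall l : list (formula (arith Sg)), (forall q, In q l -> p q) ->
     exists b, forall q, In q l -> sat M (scons b a) q) ->
  exists b, forall q, p q -> sat M (scons b a) q.

(** * Random variables and the forcing notion *)

Section Forcing.

Variables (Sg : arith_language) (D : zfset).
Variable M : structure (arith Sg) (elts D).

Let args0 : Fin.t 0 -> elts D := fun i => Fin.case0 (fun _ => elts D) i.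
Let args2 (x y : elts D) : Fin.t 2 -> elts D :=
  fun i => match i with Fin.F1 => x | Fin.FS _ => y end.

Definition mzero : elts D := fint M (inl Zero : fsym (arith Sg)) args0.
Definition mone : elts D := fint M (inl One : fsym (arith Sg)) args0.
Definition madd (x y : elts D) : elts D :=
  fint M (inl Plus : fsym (arith Sg)) (args2 x y).
Definition mmul (x y : elts D) : elts D :=
  fint M (inl Times : fsym (arith Sg)) (args2 x y).
Definition mlt (x y : elts D) : Prop :=
  rint M (inl Lt : rsym (arith Sg)) (args2 x y).
Definition mle (x y : elts D) : Prop := mlt x y \/ x = y.

Fixpoint numeral (n : nat) : elts D :=
  match n with O => mzero | S m => madd (numeral m) mone end.

Definition nonstandard (x : elts D) : Prop := forall n, x <> numeral n.

(** c is the Cantor code of (a, b) and y is the remainder of a modulo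
    1 + (x + 1) b: y is the entry at x of the sequence which c codes
    through Gödel's beta function. *)
Definition entry (c x y : elts D) : Prop :=
  exists a b q,
    madd c c = madd (mmul (madd a b) (madd (madd a b) mone)) (madd b b) /\
    let m := madd mone (mmul (madd x mone) b) in
    a = madd (mmul q m) y /\ mlt y m.

Variable W : elts D.

(** The set Ω of the elements of M below the element [W]. *)
Definition sample : Type := { x : elts D | mlt x W }.

Definition coded_fun (h : sample -> elts D) : Prop :=
  exists c, forall x : sample, entry c (proj1_sig x) (h x).

Definition coded_set (A : sample -> Prop) : Prop :=
  exists c, forall x : sample, A x <-> entry c (proj1_sig x) mone.

(** a is the M-cardinality of A. *)
Definition mcard (A : sample -> Prop) (a : elts D) : Prop :=
  exists h, coded_fun h /\
    (forall x, A x -> mlt (h x) a) /\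
    (forall x x', A x -> A x' -> h x = h x' -> x = x') /\
    (forall y, mlt y a -> exists x, A x /\ h x = y).

(** r is the standard part of a / b: the rationals p / q below r are at most
    a / b, and those above r are at least a / b. *)
Definition is_st (a b : elts D) (r : R) : Prop :=
  (0 <= r)%R /\
  forall p q : nat, 0 < q ->
    ((INR p / INR q < r)%R -> mle (mmul (numeral p) b) (mmul (numeral q) a)) /\
    ((r < INR p / INR q)%R -> mle (mmul (numeral q) a) (mmul (numeral p) b)).

(** The measure of A is r. *)
Definition measure (A : sample -> Prop) (r : R) : Prop :=
  exists a w, mcard A a /\ mcard (fun _ => True) w /\ is_st a w r.

Definition Aplus (A : sample -> Prop) : Prop :=
  coded_set A /\ exists r, measure A r /\ (0 < r)%R.

Definition almost_subset (A B : sample -> Prop) : Prop :=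
  measure (fun x => A x /\ ~ B x) 0%R.

Definition is_filter (G : (sample -> Prop) -> Prop) : Prop :=
  (exists A, G A) /\
  (forall A, G A -> Aplus A) /\
  (forall A B, G A -> Aplus B -> almost_subset A B -> G B) /\
  (forall A B, G A -> G B ->
     exists C, G C /\ almost_subset C A /\ almost_subset C B).

Definition dense (X : (sample -> Prop) -> Prop) : Prop :=
  (forall A, X A -> Aplus A) /\
  (forall A, Aplus A -> exists B, X B /\ almost_subset B A).

(** The element z of the universe is the set A. *)
Definition denotes (z : zfset) (A : sample -> Prop) : Prop :=
  forall w, mem w z <-> exists x : sample, A x /\ w = el (proj1_sig x).

Definition generic_filter (V : zfset) (G : (sample -> Prop) -> Prop) : Prop :=
  is_filter G /\
  forall X, dense X -> set_of V (fun z => exists A, X A /\ denotes z A) ->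
    exists A, X A /\ G A.

Definition Rmax : (sample -> elts D) -> Prop := coded_fun.

Section Structure.

Variables (LF : fsym (arith Sg) -> Prop) (LR : rsym (arith Sg) -> Prop).

Let L : language := sublanguage (arith Sg) LF LR.

Definition pointwise (f : fsym L) (al : Fin.t (far L f) -> sample -> elts D)
  : sample -> elts D :=
  fun x => fint M (proj1_sig f) (fun i => al i x).

(** Constants are the function symbols of arity 0. *)
Definition rv_collection (Rv : (sample -> elts D) -> Prop) : Prop :=
  (forall al, Rv al -> Rmax al) /\
  (forall f al, (forall i, Rv (al i)) -> Rv (pointwise f al)).

Variable G : (sample -> Prop) -> Prop.

(** α_G, a class of random variables. *)
Definition rv_class (al : sample -> elts D) : (sample -> elts D) -> Prop :=
  fun be => Rmax be /\ G (fun x => al x = be x).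

Variable Rv : (sample -> elts D) -> Prop.

(** The domain of M[G]^R. *)
Definition MG_dom (c : (sample -> elts D) -> Prop) : Prop :=
  exists al, Rv al /\ c = rv_class al.

(** The operations of M[G]^R, with representatives taken in R.  The function
    of f at classes (α_i)_G with α_i in R is the class of f(α_0, ...), the
    union below being over all choices of these representatives. *)
Definition MG : structure L ((sample -> elts D) -> Prop) :=
  {| fint := fun f cs be =>
       exists al, (forall i, Rv (al i) /\ cs i = rv_class (al i)) /\
                  rv_class (pointwise f al) be;
     rint := fun r cs =>
       exists al, (forall i, Rv (al i) /\ cs i = rv_class (al i)) /\
                  G (fun x => rint M (proj1_sig r) (fun i => al i x)) |}.

End Structure.

End Forcing.

(* Main.v *)
(** The definition of M[G]^R refers to representatives taken in R, so everything
    reduces to independence of these representatives: if α_G = β_G then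
    {α = β} lies in G, and {ρ(β)} contains {ρ(α)} ∩ {α = β}.  Thus one needs
    that G is closed under finite intersections and coded supersets.  As a filter
    is closed in terms of ⊆* and of positive measure, one has to know for this
    that coded sets form a Boolean algebra on which the M-cardinality is total,
    single-valued and subadditive, and that Rmax is closed under the functions of
    the language.  All this is transferred from the natural numbers, where Gödel's
    beta function codes every finite function.  Measure zero means n |A| ≤ |Ω|
    for all standard n, and positive measure means |Ω| ≤ n |A| for some standard
    n, so that each step about the measure is again a transferred inequality. *)

From Stdlib Require Import Reals List Arith Lia Lra ClassicalEpsilon.
From Stdlib Require Import FunctionalExtensionality PropExtensionality ProofIrrelevance.
From Stdlib Require Fin.
Require Import Defs.

Set Implicit Arguments.
Open Scope nat_scope.

(** * Definability uniformly in all structures *)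

Lemma no_fin0 (i : Fin.t 0) : False.
Proof. exact (Fin.case0 (fun _ => False) i). Qed.

Definition vec0 (A : Type) : Fin.t 0 -> A := fun i => Fin.case0 (fun _ => A) i.

Definition vec2 (A : Type) (x y : A) : Fin.t 2 -> A :=
  fun i => match i with Fin.F1 => x | Fin.FS _ => y end.

Definition vcons (A : Type) (n : nat) (a : A) (v : Fin.t n -> A) : Fin.t (S n) -> A :=
  fun i => Fin.caseS' i (fun _ => A) a v.

Lemma vcons_eta (A : Type) (n : nat) (v : Fin.t (S n) -> A) :
  vcons (v Fin.F1) (fun i => v (Fin.FS i)) = v.
Proof.
  apply functional_extensionality; intro i.
  apply (Fin.caseS' i); reflexivity.
Qed.

Lemma vec2_map (A B : Type) (g : A -> B) (x y : A) :
  (fun i => g (vec2 x y i)) = vec2 (g x) (g y).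
Proof.
  apply functional_extensionality; intro i.
  apply (Fin.caseS' i); [reflexivity | intro j; reflexivity].
Qed.

Section Definability.

Variable Sg : arith_language.

(** Counterparts of [mzero], [mone], [madd], [mlt], [entry] and the like over an arbitrary
    structure. At [M] they are convertible to the originals, so that transferred statements apply
    directly; only the recursion for numerals has to be matched by an induction, in [is_st_iff]. *)
Definition zero_of A (S : structure (arith Sg) A) : A :=
  fint S (inl Zero : fsym (arith Sg)) (@vec0 A).
Definition one_of A (S : structure (arith Sg) A) : A :=
  fint S (inl One : fsym (arith Sg)) (@vec0 A).
Definition add_of A (S : structure (arith Sg) A) (x y : A) : A :=
  fint S (inl Plus : fsym (arith Sg)) (vec2 x y).
Definition mul_of A (S : structure (arith Sg) A) (x y : A) : A :=
  fint S (inl Times : fsym (arith Sg)) (vec2 x y).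
Definition lt_of A (S : structure (arith Sg) A) (x y : A) : Prop :=
  rint S (inl Lt : rsym (arith Sg)) (vec2 x y).
Definition le_of A (S : structure (arith Sg) A) (x y : A) : Prop :=
  lt_of S x y \/ x = y.

Fixpoint numeral_of A (S : structure (arith Sg) A) (n : nat) : A :=
  match n with
  | O => zero_of S
  | Datatypes.S m => add_of S (numeral_of S m) (one_of S)
  end.

Definition entry_of A (S : structure (arith Sg) A) (c x y : A) : Prop :=
  exists a b q,
    add_of S c c =
      add_of S (mul_of S (add_of S a b) (add_of S (add_of S a b) (one_of S)))
               (add_of S b b) /\
    let m := add_of S (one_of S) (mul_of S (add_of S x (one_of S)) b) in
    a = add_of S (mul_of S q m) y /\ lt_of S y m.

(** The variables of the context [I] may be named arbitrarily below a bound [k];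
    bound variables are then named from [k] on, so that there is no capture. *)
Definition definable (I : Type)
    (P : forall A, structure (arith Sg) A -> (I -> A) -> Prop) : Prop :=
  forall (k : nat) (var : I -> nat), (forall i, var i < k) ->
  exists p, forall A (S : structure (arith Sg) A) e,
    sat S e p <-> P A S (fun i => e (var i)).

(** Terms bind no variables, hence no bound on the names is imposed here. *)
Definition definable_term (I : Type)
    (t : forall A, structure (arith Sg) A -> (I -> A) -> A) : Prop :=
  forall var : I -> nat,
  exists tm, forall A (S : structure (arith Sg) A) e,
    eval S e tm = t A S (fun i => e (var i)).

Lemma definable_ext I (P Q : forall A, structure (arith Sg) A -> (I -> A) -> Prop) :
  (forall A S e, P A S e <-> Q A S e) -> definable P -> definable Q.
Proof.
  intros H HP k var Hk. destruct (HP k var Hk) as [p Hp].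
  exists p; intros. rewrite Hp. apply H.
Qed.

Lemma definable_rename I J (r : I -> J) P :
  definable P -> definable (fun A S e => P A S (fun i => e (r i))).
Proof.
  intros HP k var Hk. exact (HP k (fun i => var (r i)) (fun i => Hk (r i))).
Qed.

Lemma definable_var I (i : I) : definable_term (fun A S e => e i).
Proof. intro var. exists (tvar _ (var i)). reflexivity. Qed.

Lemma definable_fint I (f : fsym (arith Sg))
    (t : Fin.t (far (arith Sg) f) -> forall A, structure (arith Sg) A -> (I -> A) -> A) :
  (forall i, definable_term (t i)) ->
  definable_term (fun A S e => fint S f (fun i => t i A S e)).
Proof.
  intros H var.
  exists (tapp f (fun i => proj1_sig (constructive_indefinite_description _ (H i var)))).
  intros A S e; simpl. f_equal. apply functional_extensionality; intro i.
  destruct (constructive_indefinite_description _ (H i var)) as [u Hu]. apply Hu.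
Qed.

Lemma definable_rint I (r : rsym (arith Sg))
    (t : Fin.t (rar (arith Sg) r) -> forall A, structure (arith Sg) A -> (I -> A) -> A) :
  (forall i, definable_term (t i)) ->
  definable (fun A S e => rint S r (fun i => t i A S e)).
Proof.
  intros H k var _.
  exists (fRel r (fun i => proj1_sig (constructive_indefinite_description _ (H i var)))).
  intros A S e; simpl.
  replace (fun i => eval S e _) with (fun i => t i A S (fun j => e (var j))).
  - reflexivity.
  - apply functional_extensionality; intro i.
    destruct (constructive_indefinite_description _ (H i var)) as [u Hu].
    symmetry; apply Hu.
Qed.

Lemma definable_zero I : definable_term (I := I) (fun A S e => zero_of S).
Proof.
  intro var. exists (tapp (inl Zero : fsym (arith Sg)) (@vec0 _)).
  intros A S e; simpl. unfold zero_of. f_equal.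
  apply functional_extensionality; intro i. destruct (no_fin0 i).
Qed.

Lemma definable_one I : definable_term (I := I) (fun A S e => one_of S).
Proof.
  intro var. exists (tapp (inl One : fsym (arith Sg)) (@vec0 _)).
  intros A S e; simpl. unfold one_of. f_equal.
  apply functional_extensionality; intro i. destruct (no_fin0 i).
Qed.

Lemma definable_add I (s t : forall A, structure (arith Sg) A -> (I -> A) -> A) :
  definable_term s -> definable_term t ->
  definable_term (fun A S e => add_of S (s A S e) (t A S e)).
Proof.
  intros Hs Ht var. destruct (Hs var) as [u Hu], (Ht var) as [v Hv].
  exists (tapp (inl Plus : fsym (arith Sg)) (vec2 u v)).
  intros A S e; simpl. rewrite (vec2_map (eval S e)), Hu, Hv. reflexivity.
Qed.

Lemma definable_mul I (s t : forall A, structure (arith Sg) A -> (I -> A) -> A) :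
  definable_term s -> definable_term t ->
  definable_term (fun A S e => mul_of S (s A S e) (t A S e)).
Proof.
  intros Hs Ht var. destruct (Hs var) as [u Hu], (Ht var) as [v Hv].
  exists (tapp (inl Times : fsym (arith Sg)) (vec2 u v)).
  intros A S e; simpl. rewrite (vec2_map (eval S e)), Hu, Hv. reflexivity.
Qed.

Lemma definable_numeral I n : definable_term (I := I) (fun A S e => numeral_of S n).
Proof.
  induction n as [|n IH]; simpl.
  - apply definable_zero.
  - apply definable_add; [exact IH | apply definable_one].
Qed.

Lemma definable_lt I (s t : forall A, structure (arith Sg) A -> (I -> A) -> A) :
  definable_term s -> definable_term t ->
  definable (fun A S e => lt_of S (s A S e) (t A S e)).
Proof.
  intros Hs Ht k var _. destruct (Hs var) as [u Hu], (Ht var) as [v Hv].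
  exists (fRel (inl Lt : rsym (arith Sg)) (vec2 u v)).
  intros A S e; simpl. rewrite (vec2_map (eval S e)), Hu, Hv. reflexivity.
Qed.

Lemma definable_eq I (s t : forall A, structure (arith Sg) A -> (I -> A) -> A) :
  definable_term s -> definable_term t ->
  definable (fun A S e => s A S e = t A S e).
Proof.
  intros Hs Ht k var _. destruct (Hs var) as [u Hu], (Ht var) as [v Hv].
  exists (fEq u v). intros A S e; simpl. rewrite Hu, Hv. reflexivity.
Qed.

Lemma definable_False I : definable (I := I) (fun A S e => False).
Proof. intros k var _. exists (fFalse _). reflexivity. Qed.

Lemma definable_imp I (P Q : forall A, structure (arith Sg) A -> (I -> A) -> Prop) :
  definable P -> definable Q -> definable (fun A S e => P A S e -> Q A S e).
Proof.
  intros HP HQ k var Hk.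
  destruct (HP k var Hk) as [p Hp], (HQ k var Hk) as [q Hq].
  exists (fImp p q). intros A S e; simpl. rewrite Hp, Hq. reflexivity.
Qed.

(** The quantified variable receives the name [k]. All names of the context lie below [k], so
    updating the assignment there does not disturb them, and the body is defined with the bound
    [S k]. *)
Lemma definable_forall I (P : forall A, structure (arith Sg) A -> (I -> A) -> A -> Prop) :
  definable (I := option I) (fun A S e => P A S (fun i => e (Some i)) (e None)) ->
  definable (fun A S e => forall a, P A S e a).
Proof.
  intros HP k var Hk.
  destruct (HP (S k) (fun o => match o with Some i => var i | None => k end)) as [p Hp].
  { intros [i|]; [specialize (Hk i)|]; lia. }
  exists (fAll k p). intros A S e; simpl.
  assert (E : forall a, (fun i => upd e k a (var i)) = (fun i => e (var i))).
  { intro a. apply functional_extensionality; intro i. unfold upd.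
    specialize (Hk i). destruct (Nat.eq_dec (var i) k); [lia | reflexivity]. }
  assert (E' : forall a, upd e k a k = a).
  { intro a. unfold upd. destruct (Nat.eq_dec k k); [reflexivity | congruence]. }
  split; intros H a; specialize (H a).
  - rewrite Hp, E, E' in H. exact H.
  - rewrite Hp, E, E'. exact H.
Qed.

Lemma definable_not I (P : forall A, structure (arith Sg) A -> (I -> A) -> Prop) :
  definable P -> definable (fun A S e => ~ P A S e).
Proof. intro HP. apply (definable_imp HP). apply definable_False. Qed.

(** Formulas are built with implication, falsity and the universal quantifier only; the other
    connectives come from classical equivalences. *)
Lemma definable_and I (P Q : forall A, structure (arith Sg) A -> (I -> A) -> Prop) :
  definable P -> definable Q -> definable (fun A S e => P A S e /\ Q A S e).
Proof.
  intros HP HQ.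
  apply definable_ext with (P := fun A S e => ~ (P A S e -> ~ Q A S e)).
  - intros A S e. pose proof (classic (P A S e)). pose proof (classic (Q A S e)). tauto.
  - apply definable_not, definable_imp, definable_not; assumption.
Qed.

Lemma definable_or I (P Q : forall A, structure (arith Sg) A -> (I -> A) -> Prop) :
  definable P -> definable Q -> definable (fun A S e => P A S e \/ Q A S e).
Proof.
  intros HP HQ.
  apply definable_ext with (P := fun A S e => ~ P A S e -> Q A S e).
  - intros A S e. pose proof (classic (P A S e)). tauto.
  - apply definable_imp; [apply definable_not|]; assumption.
Qed.

Lemma definable_iff I (P Q : forall A, structure (arith Sg) A -> (I -> A) -> Prop) :
  definable P -> definable Q -> definable (fun A S e => P A S e <-> Q A S e).
Proof.
  intros HP HQ. apply definable_and; apply definable_imp; assumption.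
Qed.

Lemma definable_exists I (P : forall A, structure (arith Sg) A -> (I -> A) -> A -> Prop) :
  definable (I := option I) (fun A S e => P A S (fun i => e (Some i)) (e None)) ->
  definable (fun A S e => exists a, P A S e a).
Proof.
  intro HP.
  apply definable_ext with (P := fun A S e => ~ forall a, ~ P A S e a).
  - intros A S e. split.
    + intro H. apply NNPP. intro H'. apply H. intros a Ha. apply H'. eauto.
    + intros [a Ha] H. exact (H a Ha).
  - apply definable_not, definable_forall, definable_not. exact HP.
Qed.

Lemma definable_forall_fin I n
    (P : Fin.t n -> forall A, structure (arith Sg) A -> (I -> A) -> Prop) :
  (forall i, definable (P i)) -> definable (fun A S e => forall i, P i A S e).
Proof.
  induction n as [|n IH]; intro H.
  - apply definable_ext with (P := fun A S e => False -> False).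
    + intros; split; [intros _ i; destruct (no_fin0 i) | tauto].
    + apply definable_imp; apply definable_False.
  - apply definable_ext
      with (P := fun A S e => P Fin.F1 A S e /\ forall i, P (Fin.FS i) A S e).
    + intros A S e; split.
      * intros [H1 H2] i. apply (Fin.caseS' i); assumption.
      * intro H'; split; [apply H' | intro; apply H'].
    + apply definable_and; [apply H | apply IH; intro; apply H].
Qed.

(** Serves for symbols of arbitrary arity. The quantifier over a vector unfolds into [n] ordinary
    ones: the first entry moves into the context as [None], and the remaining entries are handled by
    induction on the length. *)
Lemma definable_forall_vec n :
  forall I (P : forall A, structure (arith Sg) A -> (I -> A) -> (Fin.t n -> A) -> Prop),
  definable (I := I + Fin.t n)
    (fun A S e => P A S (fun i => e (inl i)) (fun j => e (inr j))) ->
  definable (fun A S e => forall v, P A S e v).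
Proof.
  induction n as [|n IH]; intros I P HP.
  - apply definable_ext with (P := fun A S e => P A S e (@vec0 A)).
    + intros A S e; split; [|auto]. intros H v.
      replace v with (@vec0 A); [exact H|].
      apply functional_extensionality; intro i. destruct (no_fin0 i).
    + apply (definable_rename
        (fun s : I + Fin.t 0 => match s with
                                | inl i => i
                                | inr j => Fin.case0 (fun _ => I) j
                                end)) in HP.
      revert HP. apply definable_ext. intros A S e.
      replace (fun j : Fin.t 0 => _) with (@vec0 A).
      * reflexivity.
      * apply functional_extensionality; intro i. destruct (no_fin0 i).
  - apply definable_ext
      with (P := fun A S e => forall a, forall v, P A S e (vcons a v)).
    + intros A S e; split; [|auto]. intros H v.
      rewrite <- (vcons_eta v). apply H.
    + apply definable_forall.
      apply (IH _ (fun A S e v => P A S (fun i => e (Some i)) (vcons (e None) v))).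
      apply (definable_rename
        (fun s : I + Fin.t (S n) =>
           match s with
           | inl i => inl (Some i)
           | inr j => vcons (inl None) (@inr (option I) _) j
           end)) in HP.
      revert HP. apply definable_ext. intros A S' e.
      match goal with |- P _ _ _ ?u <-> P _ _ _ ?v => replace u with v end.
      * reflexivity.
      * apply functional_extensionality; intro i. apply (Fin.caseS' i); reflexivity.
Qed.

Lemma definable_entry I (c x y : forall A, structure (arith Sg) A -> (I -> A) -> A) :
  definable_term c -> definable_term x -> definable_term y ->
  definable (fun A S e => entry_of S (c A S e) (x A S e) (y A S e)).
Proof.
  intros Hc Hx Hy. unfold entry_of.
  (* Weakening by a fresh variable, applied once for each of the three quantifiers of [entry_of]. *)
  assert (W : forall J (t : forall A, structure (arith Sg) A -> (J -> A) -> A),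
    definable_term t ->
    definable_term (I := option J) (fun A S e => t A S (fun i => e (Some i)))).
  { intros J t Ht var. apply (Ht (fun i => var (Some i))). }
  do 3 (apply definable_exists).
  apply W, W, W in Hc, Hx, Hy.
  apply definable_and; [|apply definable_and];
    [apply definable_eq | apply definable_eq | apply definable_lt];
    repeat first [ exact Hc | exact Hx | exact Hy | apply definable_var
                 | apply definable_one | apply definable_add | apply definable_mul ].
Qed.

End Definability.

Ltac definable :=
  cbv beta; intros;
  repeat first
    [ assumption
    | apply definable_var | apply definable_zero | apply definable_one
    | apply definable_numeral
    | apply definable_add | apply definable_mul | apply definable_fint; intro
    | apply definable_entry | apply definable_lt | apply definable_eq
    | apply definable_and | apply definable_or | apply definable_iff
    | apply definable_not | apply definable_False
    | apply definable_imp
    | apply definable_forall | apply definable_exists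
    | apply definable_forall_fin; intro | apply definable_forall_vec
    | apply definable_rint; intro ].

(** * Coding of finite functions in the natural numbers *)

Lemma crt_step P m g a :
  0 < P -> 0 < m -> Nat.gcd P m = 1 -> exists t q, a + t * P = q * m + g.
Proof.
  intros HP Hm H.
  destruct (Nat.gcd_bezout_pos P m HP) as [u [v Huv]]. rewrite H in Huv.
  destruct m as [|m]; [lia|].
  (* Here [m] is the predecessor of the modulus, so [g + m * a] is congruent to g - a modulo [S m]
     and no subtraction occurs; [u] inverts [P] modulo [S m]. *)
  exists (u * (g + m * a)), (a + v * (g + m * a)).
  replace (u * (g + m * a) * P) with (u * P * (g + m * a)) by ring.
  rewrite Huv. ring.
Qed.

Lemma gcd_1_intro a b : (forall d, Nat.divide d a -> Nat.divide d b -> d = 1) ->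
  Nat.gcd a b = 1.
Proof. intro H. apply H; [apply Nat.gcd_divide_l | apply Nat.gcd_divide_r]. Qed.

Lemma gcd_1_elim a b d : Nat.gcd a b = 1 ->
  Nat.divide d a -> Nat.divide d b -> d = 1.
Proof.
  intros H Ha Hb. apply Nat.divide_1_r. rewrite <- H. apply Nat.gcd_greatest; assumption.
Qed.

Lemma chinese_remainder (m g : nat -> nat) W :
  (forall x, x < W -> 0 < m x) ->
  (forall x y, x < y -> y < W -> Nat.gcd (m x) (m y) = 1) ->
  exists a, forall x, x < W -> exists q, a = q * m x + g x.
Proof.
  intros Hpos Hco.
  (* Invariant: [P] is a common multiple of the first [k] moduli and coprime to the later ones.
     Adding a multiple of [P] to [a] therefore keeps the remainders already arranged and can arrange
     the next one. *)
  enough (H : forall k, k <= W -> exists a P, 0 < P /\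
      (forall x, x < k -> Nat.divide (m x) P) /\
      (forall y, k <= y -> y < W -> Nat.gcd P (m y) = 1) /\
      (forall x, x < k -> exists q, a = q * m x + g x)).
  { destruct (H W (le_n W)) as [a [P [_ [_ [_ Ha]]]]]. eauto. }
  induction k as [|k IH]; intro Hk.
  - exists 0, 1. repeat split; intros; lia.
  - destruct IH as [a [P [HP [Hd [Hc Ha]]]]]; [lia|].
    destruct (@crt_step P (m k) (g k) a) as [t [q Hq]]; auto.
    exists (a + t * P), (P * m k). repeat split.
    + specialize (Hpos k Hk). nia.
    + intros x Hx. destruct (Nat.eq_dec x k) as [->|].
      * exists P. ring.
      * destruct (Hd x) as [z Hz]; [lia|]. exists (z * m k). rewrite Hz. ring.
    + intros y Hy HyW. apply gcd_1_intro. intros d H1 H2.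
      apply (@gcd_1_elim (m k) (m y)); [apply Hco; lia | | assumption].
      (* The common divisor [d] divides [m y], so it is coprime to [P]; dividing [P * m k], it
         divides [m k]. *)
      apply (Nat.gauss _ P); [assumption|].
      apply gcd_1_intro. intros d' H3 H4.
      apply (@gcd_1_elim P (m y)); [apply Hc; lia | assumption |].
      exact (Nat.divide_trans _ _ _ H3 H2).
    + intros x Hx. destruct (Nat.eq_dec x k) as [->|]; [eauto|].
      destruct (Ha x) as [q' Hq']; [lia|]. destruct (Hd x) as [z Hz]; [lia|].
      exists (q' + t * z). rewrite Hq' at 1. rewrite Hz. ring.
Qed.

Lemma divide_fact n k : 0 < k -> k <= n -> Nat.divide k (fact n).
Proof.
  intros H0. induction n as [|n IH]; intro H; [lia|].
  change (fact (S n)) with (S n * fact n).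
  destruct (Nat.eq_dec k (S n)) as [->|].
  - apply Nat.divide_factor_l.
  - apply Nat.divide_mul_r, IH. lia.
Qed.

(** A common divisor of the two moduli divides the combination in which [b] cancels, which is y - x.
    This is a positive number at most [W], so it divides [b]. Hence the divisor divides (x + 1) b as
    well as 1 + (x + 1) b. *)
Lemma beta_moduli_coprime b W x y :
  (forall k, 0 < k -> k <= W -> Nat.divide k b) -> x < y -> y < W ->
  Nat.gcd (1 + (x + 1) * b) (1 + (y + 1) * b) = 1.
Proof.
  intros Hb Hxy Hy. apply gcd_1_intro. intros d H1 H2.
  assert (Hyx : Nat.divide d (y - x)).
  { replace (y - x) with ((y + 1) * (1 + (x + 1) * b) - (x + 1) * (1 + (y + 1) * b))
      by nia.
    apply Nat.divide_sub_r; apply Nat.divide_mul_r; assumption. }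
  assert (Hdb : Nat.divide d ((x + 1) * b)).
  { apply Nat.divide_mul_r. eapply Nat.divide_trans; [exact Hyx|]. apply Hb; lia. }
  apply Nat.divide_1_r.
  replace 1 with (1 + (x + 1) * b - (x + 1) * b) by lia.
  apply Nat.divide_sub_r; assumption.
Qed.

Lemma bounded_below (g : nat -> nat) W : exists N, forall x, x < W -> g x <= N.
Proof.
  induction W as [|W [N HN]].
  - exists 0. lia.
  - exists (N + g W). intros x Hx. destruct (Nat.eq_dec x W) as [->|]; [lia|].
    specialize (HN x). lia.
Qed.

Lemma le_fact n : n <= fact n.
Proof.
  induction n as [|n IH]; [lia|]. change (fact (S n)) with (S n * fact n).
  pose proof (lt_O_fact n). nia.
Qed.

Lemma cantor_code a b : exists c, c + c = (a + b) * (a + b + 1) + (b + b).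
Proof.
  generalize (a + b). intro s. enough (H : exists c, c + c = s * (s + 1)).
  { destruct H as [c Hc]. exists (c + b). lia. }
  induction s as [|s [c Hc]]; [exists 0; reflexivity|].
  exists (c + s + 1). lia.
Qed.

Section StandardModel.

Variable Sg : arith_language.

Let N := standard Sg.

Lemma numeral_of_standard n : numeral_of N n = n.
Proof.
  induction n as [|n IH]; [reflexivity|].
  change (numeral_of N n + 1 = S n). lia.
Qed.

Lemma le_of_standard x y : le_of N x y <-> x <= y.
Proof. change (x < y \/ x = y <-> x <= y). lia. Qed.

Lemma beta_code (g : nat -> nat) W :
  exists c, forall x, x < W -> entry_of N c x (g x).
Proof.
  destruct (bounded_below g W) as [K HK].
  (* The factorial makes [b] divisible by every positive number up to [W], which gives coprime
     moduli; the summand [K] makes every modulus exceed the value to be coded. *)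
  set (b := fact (W + K)).
  assert (Hb : W + K <= b) by apply le_fact.
  destruct (@chinese_remainder (fun x => 1 + (x + 1) * b) g W) as [a Ha].
  - intros; lia.
  - intros x y. apply beta_moduli_coprime. intros k H0 Hk. apply divide_fact; lia.
  - destruct (cantor_code a b) as [c Hc]. exists c. intros x Hx.
    destruct (Ha x Hx) as [q Hq]. exists a, b, q.
    change (c + c = (a + b) * (a + b + 1) + (b + b) /\
            a = q * (1 + (x + 1) * b) + g x /\ g x < 1 + (x + 1) * b).
    repeat split; [exact Hc | exact Hq |]. specialize (HK x Hx). nia.
Qed.

(** Cantor's pairing is injective: the equation for [c] first determines a + b, because consecutive
    values of s (s + 1) differ by more than 2 s, and then [b] and [a]. It remains to use uniqueness
    of division with remainder. *)
Lemma entry_functional_standard c x y y' :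
  entry_of N c x y -> entry_of N c x y' -> y = y'.
Proof.
  intros [a [b [q [H1 [H2 H3]]]]] [a' [b' [q' [H1' [H2' H3']]]]].
  change (c + c = (a + b) * (a + b + 1) + (b + b)) in H1.
  change (a = q * (1 + (x + 1) * b) + y) in H2.
  change (y < 1 + (x + 1) * b) in H3.
  change (c + c = (a' + b') * (a' + b' + 1) + (b' + b')) in H1'.
  change (a' = q' * (1 + (x + 1) * b') + y') in H2'.
  change (y' < 1 + (x + 1) * b') in H3'.
  assert (Hs : a + b = a' + b') by nia.
  assert (b = b') by (rewrite Hs in H1; lia).
  assert (a = a') by lia. subst b' a'.
  apply (Nat.div_mod_unique (1 + (x + 1) * b) q q' y y'); try assumption.
  rewrite (Nat.mul_comm _ q), (Nat.mul_comm _ q'). lia.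
Qed.

End StandardModel.

(** The first-order form of [mcard] for the set coded by [c] below [W]: the bijection is replaced by
    its code [d], so that the notion can be transferred. The first clause says that [d] has an entry
    at each point of the sample. *)
Definition card_of Sg A (S : structure (arith Sg) A) (W c a : A) : Prop :=
  exists d,
    (forall x, lt_of S x W -> exists y, entry_of S d x y) /\
    (forall x y, lt_of S x W -> entry_of S c x (one_of S) ->
       entry_of S d x y -> lt_of S y a) /\
    (forall x x' y, lt_of S x W -> lt_of S x' W ->
       entry_of S c x (one_of S) -> entry_of S c x' (one_of S) ->
       entry_of S d x y -> entry_of S d x' y -> x = x') /\
    (forall y, lt_of S y a -> exists x, lt_of S x W /\
       entry_of S c x (one_of S) /\ entry_of S d x y).

(** * Counting in the natural numbers *)

Definition selected (P : nat -> Prop) (W : nat) : list nat :=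
  filter (fun x => if excluded_middle_informative (P x) then true else false) (seq 0 W).

Lemma in_selected P W x : In x (selected P W) <-> x < W /\ P x.
Proof.
  unfold selected. rewrite filter_In, in_seq.
  destruct (excluded_middle_informative (P x)); intuition (try lia; try discriminate).
Qed.

Lemma length_selected_subadditive (P Q R : nat -> Prop) W :
  (forall x, x < W -> P x -> Q x \/ R x) ->
  length (selected P W) <= length (selected Q W) + length (selected R W).
Proof.
  intro H.
  rewrite <- length_app. apply NoDup_incl_length.
  - apply NoDup_filter, seq_NoDup.
  - intros x Hx. apply in_selected in Hx as [Hx HP].
    apply in_or_app. rewrite !in_selected. destruct (H x Hx HP); auto.
Qed.

Lemma length_selected_bijection (P : nat -> Prop) W a (h : nat -> nat) :
  (forall x, x < W -> P x -> h x < a) ->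
  (forall x x', x < W -> x' < W -> P x -> P x' -> h x = h x' -> x = x') ->
  (forall y, y < a -> exists x, x < W /\ P x /\ h x = y) ->
  length (selected P W) = a.
Proof.
  intros H1 H2 H3.
  assert (Hnd : NoDup (map h (selected P W))).
  { apply NoDup_map_NoDup_ForallPairs.
    - intros x x' Hx Hx' E. apply in_selected in Hx, Hx'. apply H2; tauto.
    - apply NoDup_filter, seq_NoDup. }
  rewrite <- (length_map h). rewrite <- (length_seq a 0).
  apply Nat.le_antisymm; apply NoDup_incl_length; try assumption; try apply seq_NoDup.
  - intros y Hy. apply in_map_iff in Hy as [x [E Hx]]. apply in_selected in Hx.
    subst y. apply in_seq. specialize (H1 x). intuition lia.
  - intros y Hy. apply in_seq in Hy. destruct (H3 y) as [x Hx]; [lia|].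
    apply in_map_iff. exists x. rewrite in_selected. tauto.
Qed.

Lemma selected_S P W :
  length (selected P (S W)) =
  length (selected P W) + if excluded_middle_informative (P W) then 1 else 0.
Proof.
  unfold selected. rewrite seq_S, filter_app, length_app. simpl.
  destruct (excluded_middle_informative (P W)); reflexivity.
Qed.

Lemma length_selected_le P x y : x <= y -> length (selected P x) <= length (selected P y).
Proof. induction 1; [lia|]. rewrite selected_S. lia. Qed.

Lemma length_selected_lt P x y :
  x < y -> P x -> length (selected P x) < length (selected P y).
Proof.
  intros H HP. pose proof (length_selected_le P H) as H'. rewrite selected_S in H'.
  destruct (excluded_middle_informative (P x)); [lia | contradiction].
Qed.

(** The counting function grows by at most one at each step, and only at elements of [P]; the
    witness is the point at which it leaves the value [y]. *)
Lemma length_selected_onto P W y : y < length (selected P W) ->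
  exists x, x < W /\ P x /\ length (selected P x) = y.
Proof.
  induction W as [|W IH]; [simpl; lia|]. rewrite selected_S. intro H.
  destruct (Nat.lt_ge_cases y (length (selected P W))) as [Hy|Hy].
  - destruct (IH Hy) as [x Hx]. exists x. intuition lia.
  - exists W. destruct (excluded_middle_informative (P W)); intuition lia.
Qed.

Section StandardCardinality.

Variable Sg : arith_language.

Let N := standard Sg.

Lemma card_of_standard W c a :
  card_of N W c a -> length (selected (fun x => entry_of N c x 1) W) = a.
Proof.
  intros [d [H0 [H1 [H2 H3]]]].
  assert (Hh : exists h : nat -> nat, forall x, x < W -> entry_of N d x (h x)).
  { exists (fun x => epsilon (inhabits 0) (entry_of N d x)).
    intros x Hx. apply epsilon_spec, H0, Hx. }
  destruct Hh as [h Hh]. apply length_selected_bijection with (h := h).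
  - intros x Hx Hc. exact (H1 x (h x) Hx Hc (Hh x Hx)).
  - intros x x' Hx Hx' Hc Hc' E. apply (H2 x x' (h x)); auto. rewrite E; auto.
  - intros y Hy. destruct (H3 y Hy) as [x [Hx [Hc Hd]]]. exists x.
    repeat split; try assumption. eapply entry_functional_standard; eauto.
Qed.

(** The bijection is the increasing enumeration: an element is sent to the number of smaller
    elements of the set. Gödel's beta function codes this map. *)
Lemma card_of_standard_exists W c : exists a, card_of N W c a.
Proof.
  set (P := fun x => entry_of N c x 1).
  destruct (@beta_code Sg (fun x => length (selected P x)) W) as [d Hd].
  assert (Hf : forall x y, x < W -> entry_of N d x y -> y = length (selected P x)).
  { intros x y Hx H. eapply entry_functional_standard; eauto. }
  exists (length (selected P W)), d. repeat split.
  - intros x Hx. eauto.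
  - intros x y Hx Hc H. apply Hf in H; [|exact Hx]. subst y.
    apply length_selected_lt; assumption.
  - intros x x' y Hx Hx' Hc Hc' H H'. apply Hf in H, H'; try assumption.
    destruct (Nat.lt_trichotomy x x') as [h|[h|h]]; [|exact h|];
      apply (length_selected_lt P) in h; (assumption || lia).
  - intros y Hy. destruct (@length_selected_onto P W y Hy) as [x [Hx [Hc E]]].
    exists x. subst y. auto.
Qed.

Lemma card_of_standard_subadditive W c c1 c2 a a1 a2 :
  (forall x, x < W -> entry_of N c x 1 -> entry_of N c1 x 1 \/ entry_of N c2 x 1) ->
  card_of N W c a -> card_of N W c1 a1 -> card_of N W c2 a2 -> a <= a1 + a2.
Proof.
  intros H Ha Ha1 Ha2.
  apply card_of_standard in Ha, Ha1, Ha2. subst.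
  apply length_selected_subadditive. exact H.
Qed.

End StandardCardinality.

(** * Comprehension in models of true arithmetic *)

(** Turns the operations of [standard] into those of [nat] for [lia] and [nia]. Order and numerals
    need rewriting, since [le_of] is a disjunction and [numeral_of] a recursion; the rest holds by
    conversion. *)
Ltac standard :=
  cbv beta; intros;
  repeat match goal with
  | H : context [le_of (standard _) _ _] |- _ => rewrite le_of_standard in H
  | |- context [le_of (standard _) _ _] => rewrite le_of_standard
  | H : context [numeral_of (standard _) _] |- _ => rewrite numeral_of_standard in H
  | |- context [numeral_of (standard _) _] => rewrite numeral_of_standard
  end;
  repeat match goal with
  | H : context [mul_of (standard ?Sg) ?x ?y] |- _ =>
      change (mul_of (standard Sg) x y) with (x * y) in H
  | |- context [mul_of (standard ?Sg) ?x ?y] =>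
      change (mul_of (standard Sg) x y) with (x * y)
  | H : context [add_of (standard ?Sg) ?x ?y] |- _ =>
      change (add_of (standard Sg) x y) with (x + y) in H
  | |- context [add_of (standard ?Sg) ?x ?y] =>
      change (add_of (standard Sg) x y) with (x + y)
  | H : context [lt_of (standard ?Sg) ?x ?y] |- _ =>
      change (lt_of (standard Sg) x y) with (x < y) in H
  | |- context [lt_of (standard ?Sg) ?x ?y] =>
      change (lt_of (standard Sg) x y) with (x < y)
  | H : context [zero_of (standard ?Sg)] |- _ =>
      change (zero_of (standard Sg)) with 0 in H
  | |- context [zero_of (standard ?Sg)] =>
      change (zero_of (standard Sg)) with 0
  end.

Section Model.

Variables (Sg : arith_language) (D : zfset) (M : structure (arith Sg) (elts D)).
Hypothesis Htrue : models_true_arithmetic M.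

(** One formula defines [P] in all structures simultaneously, so its truth in the natural numbers
    passes to [M]. The context is empty, and the constant zero merely supplies an assignment. *)
Lemma transfer (P : forall A, structure (arith Sg) A -> Prop) :
  definable (I := Empty_set) (fun A S _ => P A S) -> P nat (standard Sg) -> P _ M.
Proof.
  intros H HN.
  destruct (H 0 (fun e : Empty_set => match e with end)) as [p Hp]; [intros []|].
  apply (Hp _ M (fun _ => zero_of M)), Htrue. intro e. apply Hp, HN.
Qed.

Lemma entry_functional c x y y' : entry M c x y -> entry M c x y' -> y = y'.
Proof.
  revert c x y y'.
  apply (transfer (fun A S => forall c x y y',
    entry_of S c x y -> entry_of S c x y' -> y = y')); [definable|].
  intros c x y y'. apply entry_functional_standard.
Qed.

(** In the natural numbers a choice of values below [W] exists and, like every function there, has a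
    beta code. What is transferred is the existence of the code, a first-order statement because the
    parameters [v] are quantified as well. *)
Lemma function_comprehension n
    (P : forall A, structure (arith Sg) A -> (Fin.t n -> A) -> A -> A -> Prop) :
  (forall J (v : Fin.t n -> J) x y,
     definable (fun A S e => P A S (fun i => e (v i)) (e x) (e y))) ->
  forall v W, (forall x, mlt M x W -> exists y, P _ M v x y) ->
  exists d, forall x, mlt M x W -> exists y, entry M d x y /\ P _ M v x y.
Proof.
  intro HP.
  apply (transfer (fun A S => forall v W,
    (forall x, lt_of S x W -> exists y, P A S v x y) ->
    exists d, forall x, lt_of S x W -> exists y, entry_of S d x y /\ P A S v x y)).
  - definable; apply HP.
  - intros v W H.
    destruct (@beta_code Sg (fun x => epsilon (inhabits 0) (P _ (standard Sg) v x)) W)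
      as [d Hd].
    exists d. intros x Hx. eexists. split; [apply Hd, Hx|].
    apply epsilon_spec, H, Hx.
Qed.

Lemma set_comprehension n
    (P : forall A, structure (arith Sg) A -> (Fin.t n -> A) -> A -> Prop) :
  (forall J (v : Fin.t n -> J) x,
     definable (fun A S e => P A S (fun i => e (v i)) (e x))) ->
  forall v W, coded_set (M := M) (W := W) (fun x => P _ M v (proj1_sig x)).
Proof.
  intros HP v W.
  enough (H : exists d, forall x, mlt M x W -> (P _ M v x <-> entry M d x (mone M))).
  { destruct H as [d Hd]. exists d. intros [x Hx]. exact (Hd x Hx). }
  revert v W.
  apply (transfer (fun A S => forall v W, exists d, forall x, lt_of S x W ->
    (P A S v x <-> entry_of S d x (one_of S)))).
  - definable; apply HP.
  - intros v W.
    (* A code of the characteristic function. Outside [P] its entry is 0, which excludes the entry 1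
       by uniqueness. *)
    destruct (@beta_code Sg (fun x =>
      if excluded_middle_informative (P _ (standard Sg) v x) then 1 else 0) W) as [d Hd].
    exists d. intros x Hx. specialize (Hd x Hx). change (one_of (standard Sg)) with 1.
    destruct (excluded_middle_informative (P _ (standard Sg) v x)); [tauto|].
    split; [contradiction|]. intro H. discriminate (entry_functional_standard Hd H).
Qed.

(** * Coded events and random variables *)

Section Sample.

Variable W : elts D.

Notation event := (sample M W -> Prop).
Notation coded A := (coded_set (M := M) (W := W) A).

Lemma coded_ext (A B : event) : (forall x, A x <-> B x) -> coded A -> coded B.
Proof. intros H [c Hc]. exists c. intro x. rewrite <- H. apply Hc. Qed.

Lemma choose_codes n (al : Fin.t n -> sample M W -> elts D) :
  (forall i, Rmax (al i)) ->
  exists v : Fin.t n -> elts D, forall i x, entry M (v i) (proj1_sig x) (al i x).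
Proof.
  intro H.
  exists (fun i => proj1_sig (constructive_indefinite_description _ (H i))).
  intro i. exact (proj2_sig (constructive_indefinite_description _ (H i))).
Qed.

(** The value of [f] at [x] is described through the codes [v] by quantifying over the vector [u] of
    their entries at [x]. Entries being unique, exactly one [u] qualifies. The same device serves in
    [coded_rint]. *)
Lemma Rmax_fint (f : fsym (arith Sg)) (al : Fin.t (far (arith Sg) f) -> sample M W -> elts D) :
  (forall i, Rmax (al i)) -> Rmax (fun x => fint M f (fun i => al i x)).
Proof.
  intro H. destruct (choose_codes _ H) as [v Hv].
  destruct (function_comprehension
    (fun A S v x y => forall u, (forall i, entry_of S (v i) x (u i)) -> y = fint S f u)
    ltac:(definable) v W) as [d Hd].
  - intros x Hx. exists (fint M f (fun i => al i (exist _ x Hx))). intros u Hu.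
    f_equal. apply functional_extensionality; intro i.
    exact (entry_functional (Hv i (exist _ x Hx)) (Hu i)).
  - exists d. intros [x Hx]. destruct (Hd x Hx) as [y [H1 H2]].
    rewrite <- (H2 _ (fun i => Hv i (exist _ x Hx))). exact H1.
Qed.

Lemma coded_rint (r : rsym (arith Sg)) (al : Fin.t (rar (arith Sg) r) -> sample M W -> elts D) :
  (forall i, Rmax (al i)) -> coded (fun x => rint M r (fun i => al i x)).
Proof.
  intro H. destruct (choose_codes _ H) as [v Hv].
  refine (coded_ext _ _ (set_comprehension
    (fun A S v x => forall u, (forall i, entry_of S (v i) x (u i)) -> rint S r u)
    ltac:(definable) v W)).
  intro x. split.
  - intro H'. exact (H' _ (fun i => Hv i x)).
  - intros H' u Hu. replace u with (fun i => al i x); [exact H'|].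
    apply functional_extensionality; intro i. exact (entry_functional (Hv i x) (Hu i)).
Qed.

Lemma coded_eq (al be : sample M W -> elts D) :
  Rmax al -> Rmax be -> coded (fun x => al x = be x).
Proof.
  intros [c Hc] [c' Hc'].
  refine (coded_ext _ _ (set_comprehension (n := 2)
    (* Both codes have exactly one entry at [x], so this implication already expresses equality of
       the values. *)
    (fun A S v x => forall y, entry_of S (v Fin.F1) x y ->
       entry_of S (v (Fin.FS Fin.F1)) x y)
    ltac:(definable) (vec2 c c') W)).
  intro x; simpl. split.
  - intro H. exact (entry_functional (H _ (Hc x)) (Hc' x)).
  - intros E y Hy. rewrite <- (entry_functional (Hc x) Hy), E. apply Hc'.
Qed.

Lemma coded_full : coded (fun _ => True).
Proof.
  refine (coded_ext _ _ (set_comprehension (n := 0) (fun A S v x => x = x)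
    ltac:(definable) (@vec0 _) W)). tauto.
Qed.

Lemma coded_inter A B : coded A -> coded B -> coded (fun x => A x /\ B x).
Proof.
  intros [c Hc] [c' Hc'].
  refine (coded_ext _ _ (set_comprehension (n := 2)
    (fun A S v x => entry_of S (v Fin.F1) x (one_of S) /\
       entry_of S (v (Fin.FS Fin.F1)) x (one_of S))
    ltac:(definable) (vec2 c c') W)).
  intro x. rewrite Hc, Hc'. reflexivity.
Qed.

Lemma coded_diff A B : coded A -> coded B -> coded (fun x => A x /\ ~ B x).
Proof.
  intros [c Hc] [c' Hc'].
  refine (coded_ext _ _ (set_comprehension (n := 2)
    (fun A S v x => entry_of S (v Fin.F1) x (one_of S) /\
       ~ entry_of S (v (Fin.FS Fin.F1)) x (one_of S))
    ltac:(definable) (vec2 c c') W)).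
  intro x. rewrite Hc, Hc'. reflexivity.
Qed.

(** * Cardinality of coded sets *)

(** A coded bijection and its code carry the same information: entries of [d] are unique, and
    [card_of] provides one at each point, so a function can be read off from the code. *)
Lemma mcard_card_of (A : event) c a :
  (forall x, A x <-> entry M c (proj1_sig x) (mone M)) ->
  mcard A a <-> card_of M W c a.
Proof.
  intro Hc. split.
  - intros [h [[d Hd] [H1 [H2 H3]]]]. exists d. repeat split.
    + intros x Hx. exists (h (exist _ x Hx)). exact (Hd (exist _ x Hx)).
    + intros x y Hx Hcx Hy.
      rewrite <- (entry_functional (Hd (exist _ x Hx)) Hy).
      apply H1, Hc, Hcx.
    + intros x x' y Hx Hx' Hcx Hcx' Hy Hy'.
      assert (E : exist (fun x => mlt M x W) x Hx = exist _ x' Hx').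
      { apply H2; [apply Hc, Hcx | apply Hc, Hcx' |].
        transitivity y; [|symmetry].
        - exact (entry_functional (Hd (exist _ x Hx)) Hy).
        - exact (entry_functional (Hd (exist _ x' Hx')) Hy'). }
      exact (f_equal (@proj1_sig _ _) E).
    + intros y Hy. destruct (H3 y Hy) as [[x Hx] [HA E]]. exists x.
      split; [exact Hx|]. split; [apply (proj1 (Hc (exist _ x Hx))), HA|].
      rewrite <- E. exact (Hd (exist _ x Hx)).
  - intros [d [H0 [H1 [H2 H3]]]].
    assert (Hd : exists h : sample M W -> elts D, forall x, entry M d (proj1_sig x) (h x)).
    { exists (fun x => epsilon (inhabits W) (entry M d (proj1_sig x))).
      intros [x Hx]. apply epsilon_spec. exact (H0 x Hx). }
    destruct Hd as [h Hd]. exists h. repeat split.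
    + exists d. exact Hd.
    + intros x HA. exact (H1 _ _ (proj2_sig x) (proj1 (Hc x) HA) (Hd x)).
    + intros x x' HA HA' E. apply eq_sig_hprop; [intros; apply proof_irrelevance|].
      apply (H2 _ _ (h x) (proj2_sig x) (proj2_sig x')).
      * apply Hc, HA.
      * apply Hc, HA'.
      * apply Hd.
      * rewrite E. apply Hd.
    + intros y Hy. destruct (H3 y Hy) as [x [Hx [Hcx Hdx]]].
      exists (exist _ x Hx). split; [apply Hc, Hcx|].
      exact (entry_functional (Hd (exist _ x Hx)) Hdx).
Qed.

Lemma mcard_exists A : coded A -> exists a, mcard A a.
Proof.
  intros [c Hc].
  assert (H : forall W c, exists a, card_of M W c a).
  { apply (transfer (fun A S => forall W c, exists a, card_of S W c a)).
    - unfold card_of; definable.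
    - intros. apply card_of_standard_exists. }
  destruct (H W c) as [a Ha]. exists a. apply (mcard_card_of _ _ Hc), Ha.
Qed.

(** The pigeonhole principle inside [M]: it concerns coded bijections only, hence follows by
    transfer from counting lists of natural numbers. *)
Lemma mcard_unique A a a' : coded A -> mcard A a -> mcard A a' -> a = a'.
Proof.
  intros [c Hc] Ha Ha'. apply (mcard_card_of _ _ Hc) in Ha, Ha'.
  revert Ha Ha'. generalize W c a a'.
  apply (transfer (fun A S => forall W c a a', card_of S W c a -> card_of S W c a' -> a = a')).
  - unfold card_of; definable.
  - intros ? ? ? ? H H'. apply card_of_standard in H, H'. congruence.
Qed.

Lemma mcard_subadditive A B C a b c :
  coded A -> coded B -> coded C -> (forall x, A x -> B x \/ C x) ->
  mcard A a -> mcard B b -> mcard C c -> mle M a (madd M b c).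
Proof.
  intros [cA HA] [cB HB] [cC HC] H Ha Hb Hc.
  apply (mcard_card_of _ _ HA) in Ha.
  apply (mcard_card_of _ _ HB) in Hb.
  apply (mcard_card_of _ _ HC) in Hc.
  assert (H' : forall x, mlt M x W -> entry M cA x (mone M) ->
    entry M cB x (mone M) \/ entry M cC x (mone M)).
  { intros x Hx Hcx. destruct (H (exist _ x Hx)) as [H1|H1].
    - apply HA, Hcx.
    - left. exact (proj1 (HB _) H1).
    - right. exact (proj1 (HC _) H1). }
  revert H' Ha Hb Hc. generalize W cA cB cC a b c.
  apply (transfer (fun A S => forall W cA cB cC a b c,
    (forall x, lt_of S x W -> entry_of S cA x (one_of S) ->
      entry_of S cB x (one_of S) \/ entry_of S cC x (one_of S)) ->
    card_of S W cA a -> card_of S W cB b -> card_of S W cC c ->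
    le_of S a (add_of S b c))).
  - unfold card_of, le_of; definable.
  - intros. apply le_of_standard. eapply card_of_standard_subadditive; eauto.
Qed.

Lemma mcard_empty (A : event) a : (forall x, ~ A x) -> mcard A a -> a = mzero M.
Proof.
  intros HA [h [_ [_ [_ H]]]].
  assert (Ha : forall y, ~ mlt M y a).
  { intros y Hy. destruct (H y Hy) as [x [Hx _]]. exact (HA x Hx). }
  revert Ha. generalize a.
  apply (transfer (fun A S => forall a, (forall y, ~ lt_of S y a) -> a = zero_of S)).
  - definable.
  - intros b Hb. specialize (Hb 0). standard. lia.
Qed.

End Sample.
End Model.

(** * Measure *)

Section Measure.

Variables (Sg : arith_language) (D : zfset) (M : structure (arith Sg) (elts D)).
Hypothesis Htrue : models_true_arithmetic M.

Notation "n [*] x" := (mmul M (numeral_of M n) x) (at level 40).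

Lemma is_st_iff a b r :
  is_st M a b r <-> (0 <= r)%R /\
  forall p q : nat, 0 < q ->
    ((INR p / INR q < r)%R -> mle M (p [*] b) (q [*] a)) /\
    ((r < INR p / INR q)%R -> mle M (q [*] a) (p [*] b)).
Proof.
  unfold is_st. replace (numeral M) with (numeral_of M); [reflexivity|].
  apply functional_extensionality; intro n.
  induction n as [|n IH]; simpl; [|rewrite IH]; reflexivity.
Qed.

Lemma multiples_le_mono p q p' q' a w :
  0 < q' -> p * q' <= p' * q -> mle M (p' [*] w) (q' [*] a) -> mle M (p [*] w) (q [*] a).
Proof.
  intros Hq H. revert a w.
  apply (transfer Htrue (fun A S => forall a w,
    le_of S (mul_of S (numeral_of S p') w) (mul_of S (numeral_of S q') a) ->
    le_of S (mul_of S (numeral_of S p) w) (mul_of S (numeral_of S q) a))).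
  - unfold le_of; definable.
  (* After multiplication by [q'] the claim is the chain p q' w ≤ p' q w ≤ q q' a, for the standard
     numbers in question. *)
  - standard. apply (Nat.mul_le_mono_pos_l _ _ q' Hq). nia.
Qed.

Lemma multiples_le_total p q a w :
  mle M (p [*] w) (q [*] a) \/ mle M (q [*] a) (p [*] w).
Proof.
  revert a w.
  apply (transfer Htrue (fun A S => forall a w,
    le_of S (mul_of S (numeral_of S p) w) (mul_of S (numeral_of S q) a) \/
    le_of S (mul_of S (numeral_of S q) a) (mul_of S (numeral_of S p) w))).
  - unfold le_of; definable.
  - standard. lia.
Qed.

Lemma multiples_le_bound p q a w :
  mlt M (mzero M) w -> mle M a w -> mle M (p [*] w) (q [*] a) -> p <= q.
Proof.
  intros Hw Ha H. apply Nat.nlt_ge. intro Hpq. revert a w Hw Ha H.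
  apply (transfer Htrue (fun A S => forall a w, lt_of S (zero_of S) w -> le_of S a w ->
    le_of S (mul_of S (numeral_of S p) w) (mul_of S (numeral_of S q) a) -> False)).
  - unfold le_of; definable.
  - standard. nia.
Qed.

Lemma INR_ratio_lt p q p' q' : 0 < q -> 0 < q' ->
  (INR p / INR q < INR p' / INR q')%R -> p * q' < p' * q.
Proof.
  intros Hq Hq' H. apply INR_lt. rewrite !mult_INR.
  apply lt_0_INR in Hq, Hq'.
  apply (Rmult_lt_compat_r (INR q * INR q')) in H; [|nra].
  replace (INR p * INR q')%R with (INR p / INR q * (INR q * INR q'))%R by (field; lra).
  replace (INR p' * INR q)%R with (INR p' / INR q' * (INR q * INR q'))%R by (field; lra).
  exact H.
Qed.

Lemma INR_ratio_nonneg p q : 0 < q -> (0 <= INR p / INR q)%R.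
Proof.
  intro Hq. apply Rle_mult_inv_pos; [apply pos_INR | apply lt_0_INR, Hq].
Qed.

(** The standard part is the supremum of the standard fractions that are at most a / w; they are
    bounded by 1 because a ≤ w. The second conclusion yields the positive lower bound in
    [Aplus_iff]. *)
Lemma standard_part_exists a w : mlt M (mzero M) w -> mle M a w ->
  exists r, is_st M a w r /\
    forall p q, 0 < q -> mle M (p [*] w) (q [*] a) -> (INR p / INR q <= r)%R.
Proof.
  intros Hw Ha.
  set (E := fun s => exists p q, 0 < q /\ s = (INR p / INR q)%R /\
                                 mle M (p [*] w) (q [*] a)).
  assert (H0 : mle M (0 [*] w) (1 [*] a)).
  { clear Hw Ha E. revert a w.
    apply (transfer Htrue (fun A S => forall a w,
      le_of S (mul_of S (numeral_of S 0) w) (mul_of S (numeral_of S 1) a))).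
    - unfold le_of; definable.
    - standard. lia. }
  destruct (completeness E) as [r [Hub Hlub]].
  - exists 1%R. intros s [p [q [Hq [-> H]]]].
    pose proof (le_INR _ _ (multiples_le_bound _ _ Hw Ha H)). apply lt_0_INR in Hq.
    apply Rmult_le_reg_r with (INR q); [exact Hq|].
    replace (INR p / INR q * INR q)%R with (INR p) by (field; lra). lra.
  - exists (INR 0 / INR 1)%R, 0, 1. auto.
  - exists r. rewrite is_st_iff. split; [split|].
    + apply Rle_trans with (INR 0 / INR 1)%R; [simpl; lra|].
      apply Hub. exists 0, 1. auto.
    + intros p q Hq. split; intro Hr.
      * destruct (classic (exists s, E s /\ (INR p / INR q < s)%R)) as [[s [Hs Hlt]]|Hno].
        -- destruct Hs as [p' [q' [Hq' [-> H]]]].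
           apply INR_ratio_lt in Hlt; try assumption.
           apply multiples_le_mono with p' q'; [assumption | lia | assumption].
        -- exfalso. apply (Rlt_not_le _ _ Hr), Hlub. intros s Hs.
           apply Rnot_lt_le. intro Hlt. apply Hno. eauto.
      * destruct (multiples_le_total p q a w) as [H|H]; [|exact H].
        exfalso. apply (Rlt_not_le _ _ Hr), Hub. exists p, q. auto.
    + intros p q Hq H. apply Hub. exists p, q. auto.
Qed.

Lemma is_st_zero a w : is_st M a w 0 <-> forall n, mle M (n [*] a) w.
Proof.
  assert (Hscale : forall p q, 0 < p -> mle M (q [*] a) w -> mle M (q [*] a) (p [*] w)).
  { intros p q Hp. generalize a w.
    apply (transfer Htrue (fun A S => forall a w,
      le_of S (mul_of S (numeral_of S q) a) w ->
      le_of S (mul_of S (numeral_of S q) a) (mul_of S (numeral_of S p) w))).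
    - unfold le_of; definable.
    - standard. nia. }
  rewrite is_st_iff. split.
  - intros [_ H] n.
    (* The fraction 1 / (n + 1) lies above the standard part 0; the successor keeps its denominator
       positive when [n] is 0. *)
    assert (Hn : mle M (S n [*] a) (1 [*] w)).
    { apply (H 1 (S n)); [lia|]. pose proof (lt_0_INR (S n)).
      apply Rdiv_lt_0_compat; [simpl; lra | apply H0; lia]. }
    revert Hn. generalize a w.
    apply (transfer Htrue (fun A S' => forall a w,
      le_of S' (mul_of S' (numeral_of S' (S n)) a) (mul_of S' (numeral_of S' 1) w) ->
      le_of S' (mul_of S' (numeral_of S' n) a) w)).
    + unfold le_of; definable.
    + standard. nia.
  - intro H. split; [lra|]. intros p q Hq. split; intro Hr.
    + exfalso. pose proof (INR_ratio_nonneg p Hq). lra.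
    + apply Hscale; [|apply H]. destruct p; [|lia].
      exfalso. simpl in Hr. unfold Rdiv in Hr. lra.
Qed.

(** * Measure zero and positive measure for coded sets *)

Section Sample.

Variables (W : elts D) (w : elts D).
Hypothesis HW : W <> mzero M.
Hypothesis Hw : mcard (fun _ : sample M W => True) w.

Notation coded A := (coded_set (M := M) (W := W) A).

Lemma card_sample_positive : mlt M (mzero M) w.
Proof.
  assert (Hpos : forall x : elts D, x <> mzero M -> mlt M (mzero M) x).
  { apply (transfer Htrue (fun A S => forall x : A, x <> zero_of S -> lt_of S (zero_of S) x)).
    - definable.
    - standard. lia. }
  apply Hpos. intros ->. destruct Hw as [h [_ [H _]]].
  (* As [W] is not 0, the sample contains 0, whose image under the bijection would have to lie below
     0. *)
  pose (x0 := exist (fun x => mlt M x W) (mzero M) (Hpos W HW) : sample M W).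
  specialize (H x0 I). revert H. generalize (h x0).
  apply (transfer Htrue (fun A S => forall x, ~ lt_of S x (zero_of S))).
  - definable.
  - standard. lia.
Qed.

Lemma card_le_sample A a : coded A -> mcard A a -> mle M a w.
Proof.
  intros HA Ha.
  (* The empty set, written as A minus A: monotonicity is subadditivity for the cover of A by Ω and
     the empty set. *)
  destruct (mcard_exists Htrue (coded_diff Htrue HA HA)) as [z Hz].
  assert (Ez : z = mzero M) by (eapply (mcard_empty Htrue); [|exact Hz]; simpl; tauto).
  subst z.
  assert (H : mle M a (madd M w (mzero M))).
  { eapply (mcard_subadditive Htrue); [| | | |exact Ha|exact Hw|exact Hz]; auto.
    - apply (coded_full Htrue).
    - apply (coded_diff Htrue HA HA). }
  revert H. generalize a w.
  apply (transfer Htrue (fun A S => forall a w, le_of S a (add_of S w (zero_of S)) -> le_of S a w)).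
  - unfold le_of; definable.
  - standard. lia.
Qed.

Lemma measure_is_st A a r : coded A -> mcard A a -> measure A r <-> is_st M a w r.
Proof.
  intros HA Ha. split.
  - intros [a' [w' [Ha' [Hw' H]]]].
    rewrite (mcard_unique Htrue HA Ha Ha'),
      (mcard_unique Htrue (coded_full Htrue W) Hw Hw'). exact H.
  - intro H. exists a, w. auto.
Qed.

Lemma measure_zero_iff A a : coded A -> mcard A a ->
  measure A 0 <-> forall n, mle M (n [*] a) w.
Proof. intros HA Ha. rewrite (measure_is_st _ HA Ha). apply is_st_zero. Qed.

Lemma Aplus_iff A a : coded A -> mcard A a -> Aplus A <-> exists n, mle M w (n [*] a).
Proof.
  intros HA Ha. split.
  - intros [_ [r [H Hr]]]. apply (measure_is_st _ HA Ha), is_st_iff in H as [_ H].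
    (* A standard [n] with 1 / n < r gives |Ω| ≤ n |A| by the definition of the standard part. *)
    destruct (archimed_cor1 r Hr) as [n [Hn Hn0]]. exists n.
    assert (H1 : mle M (1 [*] w) (n [*] a)).
    { apply (H 1 n Hn0). simpl. unfold Rdiv. lra. }
    revert H1. generalize a w.
    apply (transfer Htrue (fun A S => forall a w,
      le_of S (mul_of S (numeral_of S 1) w) (mul_of S (numeral_of S n) a) ->
      le_of S w (mul_of S (numeral_of S n) a))).
    + unfold le_of; definable.
    + standard. lia.
  - intros [n Hn]. split; [exact HA|].
    destruct (@standard_part_exists a w card_sample_positive (card_le_sample HA Ha))
      as [r [Hr Hsup]].
    exists r. split; [apply (measure_is_st _ HA Ha), Hr|].
    apply Rlt_le_trans with (INR 1 / INR (S n))%R.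
    + apply Rdiv_lt_0_compat; apply lt_0_INR; lia.
    + apply Hsup; [lia|]. revert Hn. generalize a w.
      apply (transfer Htrue (fun A S' => forall a w,
        le_of S' w (mul_of S' (numeral_of S' n) a) ->
        le_of S' (mul_of S' (numeral_of S' 1) w) (mul_of S' (numeral_of S' (S n)) a))).
      * unfold le_of; definable.
      * standard. nia.
Qed.

Lemma measure_zero_subset A B C : coded A -> coded B -> coded C ->
  (forall x, A x -> B x \/ C x) -> measure B 0 -> measure C 0 -> measure A 0.
Proof.
  intros HA HB HC Hsub H1 H2.
  destruct (mcard_exists Htrue HA) as [a Ha], (mcard_exists Htrue HB) as [b Hb],
    (mcard_exists Htrue HC) as [c Hc].
  apply (measure_zero_iff HA Ha). intro n.
  (* The factor 2 n leaves room for both summands: n a ≤ n b + n c, and each of these is at most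
     half of [w]. *)
  pose proof (proj1 (measure_zero_iff HB Hb) H1 (2 * n)) as Hb'.
  pose proof (proj1 (measure_zero_iff HC Hc) H2 (2 * n)) as Hc'.
  pose proof (mcard_subadditive Htrue HA HB HC Hsub Ha Hb Hc) as Habc.
  revert Hb' Hc' Habc. generalize a b c w.
  apply (transfer Htrue (fun A S => forall a b c w,
    le_of S (mul_of S (numeral_of S (2 * n)) b) w ->
    le_of S (mul_of S (numeral_of S (2 * n)) c) w ->
    le_of S a (add_of S b c) -> le_of S (mul_of S (numeral_of S n) a) w)).
  - unfold le_of; definable.
  - standard. nia.
Qed.

Lemma Aplus_almost_superset A B : coded B -> Aplus A -> almost_subset A B -> Aplus B.
Proof.
  intros HB H1 H2. pose proof (proj1 H1) as HA.
  pose proof (coded_diff Htrue HA HB) as HC.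
  destruct (mcard_exists Htrue HA) as [a Ha], (mcard_exists Htrue HB) as [b Hb],
    (mcard_exists Htrue HC) as [c Hc].
  apply (Aplus_iff HA Ha) in H1 as [n Hn].
  (* With w ≤ n a ≤ n b + n c and n c at most half of [w], at least half of [w] is left for n b;
     hence the factor 2 n for B below. *)
  pose proof (proj1 (measure_zero_iff HC Hc) H2 (2 * n)) as Hc'.
  assert (Habc : mle M a (madd M b c)).
  { apply (mcard_subadditive Htrue HA HB HC); try assumption.
    intro x. destruct (classic (B x)); tauto. }
  apply (Aplus_iff HB Hb). exists (2 * n).
  revert Hn Hc' Habc. generalize a b c w.
  apply (transfer Htrue (fun A S => forall a b c w,
    le_of S w (mul_of S (numeral_of S n) a) ->
    le_of S (mul_of S (numeral_of S (2 * n)) c) w ->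
    le_of S a (add_of S b c) -> le_of S w (mul_of S (numeral_of S (2 * n)) b))).
  - unfold le_of; definable.
  - standard. nia.
Qed.

Lemma measure_zero_empty A : coded A -> (forall x, ~ A x) -> measure A 0.
Proof.
  intros HA H. destruct (mcard_exists Htrue HA) as [a Ha].
  apply (measure_zero_iff HA Ha). intro n. rewrite (mcard_empty Htrue H Ha).
  generalize w.
  apply (transfer Htrue (fun A S => forall w,
    le_of S (mul_of S (numeral_of S n) (zero_of S)) w)).
  - unfold le_of; definable.
  - standard. lia.
Qed.

(** * Filters *)

Variable G : (sample M W -> Prop) -> Prop.
Hypothesis HG : is_filter G.

Lemma filter_coded A : G A -> coded A.
Proof. intro H. apply HG, H. Qed.

(** A filter is only assumed closed under almost supersets of positive measure; positivity is
    inherited from A, so being coded suffices. *)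
Lemma filter_almost_superset A B : G A -> coded B -> almost_subset A B -> G B.
Proof.
  destruct HG as [_ [H1 [H2 _]]]. intros HA HB H. apply (H2 A B HA); [|exact H].
  exact (Aplus_almost_superset HB (H1 A HA) H).
Qed.

Lemma filter_superset A B : G A -> coded B -> (forall x, A x -> B x) -> G B.
Proof.
  intros HA HB H. apply (filter_almost_superset HA HB).
  apply measure_zero_empty.
  - apply (coded_diff Htrue); [apply filter_coded, HA | exact HB].
  - intros x [H1 H2]. auto.
Qed.

Lemma filter_full : G (fun _ => True).
Proof.
  destruct HG as [[A HA] _]. apply (filter_superset HA); [apply (coded_full Htrue) | auto].
Qed.

(** The filter supplies C almost contained in A and in B. The part of C outside the intersection is
    covered by C minus A and C minus B, two null sets. *)
Lemma filter_inter A B : G A -> G B -> G (fun x => A x /\ B x).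
Proof.
  intros HA HB. pose proof (filter_coded HA) as HcA. pose proof (filter_coded HB) as HcB.
  pose proof (coded_inter Htrue HcA HcB) as HcAB.
  destruct (proj2 (proj2 (proj2 HG)) A B HA HB) as [C [HC [H1 H2]]].
  pose proof (filter_coded HC) as HcC.
  apply (filter_almost_superset HC HcAB).
  apply (measure_zero_subset (B := fun x => C x /\ ~ A x) (C := fun x => C x /\ ~ B x));
    try assumption; try (apply (coded_diff Htrue); assumption).
  intros x [Hx HAB]. destruct (classic (A x)); tauto.
Qed.

Lemma filter_inter_fin n (P : Fin.t n -> sample M W -> Prop) :
  (forall i, G (P i)) -> G (fun x => forall i, P i x).
Proof.
  induction n as [|n IH]; intro H.
  - replace (fun x => forall i, P i x) with (fun _ : sample M W => True);
      [apply filter_full|].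
    apply functional_extensionality; intro x. apply propositional_extensionality.
    split; [intros _ i; destruct (no_fin0 i) | auto].
  - replace (fun x => forall i, P i x)
      with (fun x => P Fin.F1 x /\ forall i, P (Fin.FS i) x).
    + apply filter_inter; [apply H|].
      apply (IH (fun i => P (Fin.FS i))). intro i. apply H.
    + apply functional_extensionality; intro x. apply propositional_extensionality.
      split.
      * intros [H1 H2] i. apply (Fin.caseS' i); assumption.
      * intro H'; split; [apply H' | intro; apply H'].
Qed.

(** * The structures of classes of random variables *)

Lemma filter_eq_trans (al be ga : sample M W -> elts D) : Rmax al -> Rmax ga ->
  G (fun x => al x = be x) -> G (fun x => be x = ga x) -> G (fun x => al x = ga x).
Proof.
  intros Ha Hc H1 H2. apply (filter_superset (filter_inter H1 H2)).
  - apply (coded_eq Htrue Ha Hc).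
  - intros x [E1 E2]. congruence.
Qed.

Lemma filter_eq_sym (al be : sample M W -> elts D) :
  G (fun x => al x = be x) -> G (fun x => be x = al x).
Proof.
  intro H. replace (fun x => be x = al x) with (fun x => al x = be x); [exact H|].
  apply functional_extensionality; intro x. apply propositional_extensionality.
  split; auto.
Qed.

(** From left to right, [be] belongs to its own class because Ω lies in [G], hence it belongs to the
    class of [al]. The converse is transitivity of equality modulo [G]. *)
Lemma rv_class_eq (al be : sample M W -> elts D) : Rmax al -> Rmax be ->
  rv_class G al = rv_class G be <-> G (fun x => al x = be x).
Proof.
  intros Ha Hb. split.
  - intro E. assert (H : rv_class G be be).
    { split; [exact Hb|]. apply (filter_superset filter_full); [|reflexivity].
      apply (coded_eq Htrue Hb Hb). }
    rewrite <- E in H. apply H.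
  - intro H. apply functional_extensionality; intro ga. apply propositional_extensionality.
    unfold rv_class. split; intros [Hc H']; split; auto.
    + apply (filter_eq_trans _ Hb Hc (filter_eq_sym _ _ H) H').
    + apply (filter_eq_trans _ Ha Hc H H').
Qed.

Variables (LF : fsym (arith Sg) -> Prop) (LR : rsym (arith Sg) -> Prop).

Let L := sublanguage (arith Sg) LF LR.

Lemma Rmax_collection : rv_collection LF LR (@Rmax _ _ M W).
Proof.
  split; [auto|]. intros f al H. exact (Rmax_fint Htrue (proj1_sig f) al H).
Qed.

Lemma rv_class_eq_fin n (al be : Fin.t n -> sample M W -> elts D) :
  (forall i, Rmax (al i)) -> (forall i, Rmax (be i)) ->
  (forall i, rv_class G (al i) = rv_class G (be i)) ->
  G (fun x => forall i, al i x = be i x).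
Proof.
  intros Ha Hb E. apply filter_inter_fin with (P := fun i x => al i x = be i x).
  intro i. apply (rv_class_eq (Ha i) (Hb i)), E.
Qed.

Lemma rv_class_pointwise (f : fsym L) (al be : Fin.t (far L f) -> sample M W -> elts D) :
  (forall i, Rmax (al i)) -> (forall i, Rmax (be i)) ->
  (forall i, rv_class G (al i) = rv_class G (be i)) ->
  rv_class G (pointwise f al) = rv_class G (pointwise f be).
Proof.
  intros Ha Hb E.
  pose proof (proj2 Rmax_collection f al Ha) as Hfa.
  pose proof (proj2 Rmax_collection f be Hb) as Hfb.
  apply (rv_class_eq Hfa Hfb).
  apply (filter_superset (rv_class_eq_fin _ _ Ha Hb E)); [apply (coded_eq Htrue Hfa Hfb)|].
  intros x Hx. unfold pointwise. f_equal. apply functional_extensionality, Hx.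
Qed.

Lemma filter_rint (r : rsym L) (al be : Fin.t (rar L r) -> sample M W -> elts D) :
  (forall i, Rmax (al i)) -> (forall i, Rmax (be i)) ->
  (forall i, rv_class G (al i) = rv_class G (be i)) ->
  G (fun x => rint M (proj1_sig r) (fun i => al i x)) ->
  G (fun x => rint M (proj1_sig r) (fun i => be i x)).
Proof.
  intros Ha Hb E H.
  apply (filter_superset (filter_inter H (rv_class_eq_fin _ _ Ha Hb E))).
  - exact (coded_rint Htrue (proj1_sig r) be Hb).
  - intros x [H1 H2]. refine (eq_ind _ (rint M (proj1_sig r)) H1 _ _).
    apply functional_extensionality, H2.
Qed.

Lemma MG_dom_choice n (Rv : (sample M W -> elts D) -> Prop)
    (cs : Fin.t n -> (sample M W -> elts D) -> Prop) :
  (forall i, MG_dom G Rv (cs i)) ->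
  exists al, (forall i, Rv (al i)) /\ cs = (fun i => rv_class G (al i)).
Proof.
  intro H.
  exists (fun i => proj1_sig (constructive_indefinite_description _ (H i))). split.
  - intro i. destruct (constructive_indefinite_description _ (H i)) as [al Hal]. apply Hal.
  - apply functional_extensionality; intro i.
    destruct (constructive_indefinite_description _ (H i)) as [al Hal]. apply Hal.
Qed.

(** All choices of representatives give the same class by [rv_class_pointwise], so the union in [MG]
    collapses to a single class. *)
Lemma fint_MG (Rv : (sample M W -> elts D) -> Prop) (f : fsym L)
    (al : Fin.t (far L f) -> sample M W -> elts D) :
  (forall al, Rv al -> Rmax al) -> (forall i, Rv (al i)) ->
  fint (MG LF LR G Rv) f (fun i => rv_class G (al i)) = rv_class G (pointwise f al).
Proof.
  intros HR Ha. apply functional_extensionality; intro ga.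
  apply propositional_extensionality. simpl. split.
  - intros [be [Hbe H]]. rewrite (rv_class_pointwise f al be); [exact H| | |];
      intro i; [apply HR, Ha | apply HR, Hbe | apply Hbe].
  - intro H. exists al. auto.
Qed.

Lemma rint_MG (Rv : (sample M W -> elts D) -> Prop) (r : rsym L)
    (al : Fin.t (rar L r) -> sample M W -> elts D) :
  (forall al, Rv al -> Rmax al) -> (forall i, Rv (al i)) ->
  rint (MG LF LR G Rv) r (fun i => rv_class G (al i)) <->
  G (fun x => rint M (proj1_sig r) (fun i => al i x)).
Proof.
  intros HR Ha. simpl. split.
  - intros [be [Hbe H]]. revert H. apply filter_rint; auto.
    + intro i. apply HR, Hbe.
    + intro i. symmetry. apply Hbe.
  - intro H. exists al. auto.
Qed.

Lemma MG_closed (Rv : (sample M W -> elts D) -> Prop) :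
  rv_collection LF LR Rv -> closed_under_functions (MG LF LR G Rv) (MG_dom G Rv).
Proof.
  intros [HR HF] f cs Hcs. destruct (MG_dom_choice _ Hcs) as [al [Hal ->]].
  rewrite fint_MG; auto. exists (pointwise f al). auto.
Qed.

(** At classes of elements of [Rv], [fint_MG] and [rint_MG] express the operations by terms that do
    not mention [Rv]. The same representatives lie in [Rmax], so both structures compute the
    same. *)
Lemma MG_substructure (Rv : (sample M W -> elts D) -> Prop) :
  rv_collection LF LR Rv ->
  is_substructure (MG LF LR G Rv) (MG_dom G Rv)
                  (MG LF LR G (Rmax (W := W))) (MG_dom G (Rmax (W := W))).
Proof.
  intro HRv. split; [|split; [|split; [|split]]].
  - apply MG_closed, HRv.
  - apply MG_closed, Rmax_collection.
  - intros c [al [Hal E]]. exists al. split; [apply HRv, Hal | exact E].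
  - intros f cs Hcs. destruct (MG_dom_choice _ Hcs) as [al [Hal ->]].
    rewrite !fint_MG; auto; apply HRv || (intro i; apply HRv, Hal).
  - intros r cs Hcs. destruct (MG_dom_choice _ Hcs) as [al [Hal ->]].
    rewrite !rint_MG; auto; try reflexivity; apply HRv || (intro i; apply HRv, Hal).
Qed.

End Sample.
End Measure.

(** * Atomic formulas in substructures *)

Section Substructure.

Variables (L : language) (A : Type) (S T : structure L A) (X Y : A -> Prop).
Hypothesis H : is_substructure S X T Y.

(** Membership in [X] is carried through the induction because the operations are known to agree
    only at arguments from [X]. *)
Lemma substructure_eval e : (forall n, X (e n)) ->
  forall t, X (eval S e t) /\ eval S e t = eval T e t.
Proof.
  destruct H as [HX [_ [_ [HF _]]]].
  intros He t. induction t as [n|f args IH]; simpl; [auto|].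
  assert (Hargs : forall i, X (eval S e (args i))) by (intro i; apply IH).
  split; [apply HX, Hargs|]. rewrite (HF f _ Hargs). f_equal.
  apply functional_extensionality; intro i. apply IH.
Qed.

Lemma substructure_sat_atomic e p : (forall n, X (e n)) -> atomic p ->
  sat S e p <-> sat T e p.
Proof.
  intros He Hp. pose proof (substructure_eval _ He) as Ht.
  destruct p as [s t|r args| | |]; simpl in Hp |- *; try contradiction.
  - rewrite !(proj2 (Ht _)). reflexivity.
  - destruct H as [_ [_ [_ [_ HR]]]]. rewrite (HR r); [|intro i; apply Ht].
    replace (fun i => eval S e (args i)) with (fun i => eval T e (args i)); [reflexivity|].
    apply functional_extensionality; intro i. symmetry. apply Ht.
Qed.

End Substructure.

Theorem theorem5p19
  (V : zfset) (HV : countable_transitive_model V) (HCH : models_CH V)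
  (Sg : arith_language) (HSg : language_in V Sg)
  (D : zfset) (M : structure (arith Sg) (elts D)) (HM : structure_in V M)
  (Htrue : models_true_arithmetic M)
  (Hns : exists x, nonstandard M x)
  (Hsat : omega1_saturated_in V M)
  (Hcard : card_omega1_in V D)
  (W : elts D) (HW : nonstandard M W)
  (LF : fsym (arith Sg) -> Prop) (LR : rsym (arith Sg) -> Prop)
  (Rv : (sample M W -> elts D) -> Prop) (HRv : rv_collection LF LR Rv)
  (G : (sample M W -> Prop) -> Prop) (HG : generic_filter V G) :
  is_substructure (MG LF LR G Rv) (MG_dom G Rv)
                  (MG LF LR G (Rmax (W := W))) (MG_dom G (Rmax (W := W))) /\
  (forall (p : formula (sublanguage (arith Sg) LF LR))
          (al : nat -> sample M W -> elts D),
     atomic p -> (forall i, Rv (al i)) ->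
     (sat (MG LF LR G Rv) (fun i => rv_class G (al i)) p <->
      sat (MG LF LR G (Rmax (W := W))) (fun i => rv_class G (al i)) p)).
Proof.
  destruct (mcard_exists Htrue (coded_full Htrue W)) as [w Hw].
  (* [HW 0] says that [W] differs from zero, so that the sample is inhabited. *)
  assert (Hsub := MG_substructure Htrue (HW 0) Hw (proj1 HG) HRv).
  split; [exact Hsub|].
  intros p al Hp Hal. apply (substructure_sat_atomic Hsub); [|exact Hp].
  intro i. exists (al i). auto.
Qed.
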